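(* Let $n\ge2$ and $r\in\{1,\ldots,n-1\}$, and let $\mu\vdash(n-r)$ and $\nu\vdash r$ be two partitions. Then $$\mathbf{P}_\mu\star\boldsymbol{\mathcal{P}}_\nu=\sum_{\lambda}c_{\mu\nu}^\lambda(t)\,\mathbf{P}_\lambda,$$ summed over partitions $\lambda$ of $n$, where $c_{\mu\nu}^\lambda(t)=[P_\lambda](P_\mu P_\nu)\in\mathbb{Z}[t]$ is the coefficient of $P_\lambda$ in the expansion of the product $P_\mu P_\nu$ of classical Hall-Littlewood functions. Consequently, when $t=0$, $$\mathbf{S}_\mu\star\mathbf{s}_\nu=\sum_\lambda c_{\mu\nu}^\lambda\,\mathbf{S}_\lambda,$$ where $c_{\mu\nu}^\lambda=c_{\mu\nu}^\lambda(0)$ is the Littlewood-Richardson coefficient.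
   Context: Noncommuting variables $\mathbf{x}=(\mathbf{x}_1,\mathbf{x}_2,\ldots)$; coefficients are polynomials in $t$. A permutation $\delta\in\mathfrak{S}_n$ acts on degree-$n$ monomials by $\delta\circ(\mathbf{x}_{i_1}\cdots\mathbf{x}_{i_n})=\mathbf{x}_{i_{\delta^{-1}(1)}}\cdots\mathbf{x}_{i_{\delta^{-1}(n)}}$, extended linearly. For a set partition $\sigma\vdash[n]$, $\mathbf{m}_\sigma=\sum\mathbf{x}_{i_1}\cdots\mathbf{x}_{i_n}$ over tuples of positive integers with $i_a=i_b$ iff $a,b$ lie in the same block of $\sigma$; $\lambda(\sigma)$ is the partition of $n$ formed by the block sizes. For a partition $\mu=(\mu_1,\ldots,\mu_l)$, $\mu!=\mu_1!\cdots\mu_l!$. Star product. For $1\le r<n$ let $$\mathcal{S}_{r,n}=\{(i_r\ n)(i_{r-1}\ n-1)\cdots(i_1\ n-r+1): 1\le i_k\le n-r+k,\ 1\le k\le r\}\subseteq\mathfrak{S}_n,$$ where $(i\ j)$ is the transposition of $i$ and $j$ (the identity if $i=j$); permutations are composed right to left, and this is a set of representatives of the left cosets $\delta\,\mathfrak{S}_{n-r}$ in $\mathfrak{S}_n$. For $\mathcal{F},\mathcal{G}$ homogeneous power series in the noncommuting variables of degrees $n-r$ and $r$ respectively, $\mathcal{F}\star\mathcal{G}=\sum_{\delta\in\mathcal{S}_{r,n}}\delta^{-1}\circ(\mathcal{F}\mathcal{G})$. HL functions. $P_\lambda=P_\lambda(X;t)$ is the classical Hall-Littlewood symmetric function in commuting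 variables, and $c_{\lambda\mu}(t)\in\mathbb{Z}[t]$ are defined by $P_\lambda=\sum_{\mu\le\lambda}c_{\lambda\mu}(t)m_\mu$ ($\le$ is dominance order). The lifted HL function indexed by a partition $\lambda$ is $$\mathbf{P}_\lambda=\mathbf{P}_\lambda(\mathbf{x};t)=\sum_{\mu\le\lambda}\mu!\,c_{\lambda\mu}(t)\sum_{\lambda(\sigma)=\mu}\mathbf{m}_\sigma,$$ and $\mathbf{S}_\lambda$ is $\mathbf{P}_\lambda$ at $t=0$. The non-lifted HL function indexed by $\nu\vdash r$ is $$\boldsymbol{\mathcal{P}}_\nu=\boldsymbol{\mathcal{P}}_\nu(\mathbf{x};t)=\sum_{T\in\mathrm{SSYT}(\nu)}\psi_T(t)\,\mathbf{x}_{c(T_1)}\mathbf{x}_{c(T_2)}\cdots\mathbf{x}_{c(T_r)},$$ where $\mathrm{SSYT}(\nu)$ is the set of semistandard Young tableaux of shape $\nu$ (positive integer entries, rows weakly increasing, columns strictly increasing), $T_1,\ldots,T_r$ are the boxes read row by row from top to bottom and left to right within each row, and $c(T_i)$ is the entry of box $T_i$; $\mathbf{s}_\nu$ is $\boldsymbol{\mathcal{P}}_\nu$ at $t=0$. The weight $\psi_T(t)$ is defined as follows: $T$ corresponds to a chain $\emptyset=\lambda^0\subset\lambda^1\subset\cdots\subset\lambda^k=\nu$ where $\lambda^i/\lambda^{i-1}$ is the horizontal strip of boxes containing the $i$th smallest distinct entry of $T$; $\psi_T(t)=\prod_{i=1}^k\psi_{\lambda^i/\lambda^{i-1}}(t)$,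 where for a horizontal strip $\theta=\alpha/\beta$, $\psi_{\alpha/\beta}(t)=\prod_{j\in J}(1-t^{m_j(\beta)})$, with $J$ the set of $j\ge1$ such that column $j$ of $\theta$ is empty and column $j+1$ of $\theta$ contains a box, and $m_j(\beta)$ the multiplicity of the part $j$ in $\beta$. *)

(* Defs.v *)
From HB Require Import structures.
From Stdlib Require Import ClassicalEpsilon.
From mathcomp Require Import all_boot all_order all_fingroup all_algebra.
From mathcomp Require Import mpoly.

Set Implicit Arguments.
Unset Strict Implicit.
Unset Printing Implicit Defensive.

Import GRing.Theory.
Local Open Scope ring_scope.

(* The coefficient ring Z[t] is {poly int}, with t := 'X.  Variables and
   tableau entries are numbered from 0: the letter i : nat stands for x_{i+1},
   which preserves the order of the positive integers. *)

Definition is_part (n : nat) (s : seq nat) : bool :=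
  [&& sorted geq s, 0%N \notin s & sumn s == n].

Record intpart (n : nat) := IntPart {
  parts :> seq nat;
  _ : is_part n parts
}.

HB.instance Definition _ n := [isSub for @parts n].
HB.instance Definition _ n := [Countable of intpart n by <:].

Section IntpartFin.
Variable n : nat.

Definition intpart_code (p : intpart n) : {bseq n of 'I_n.+1} :=
  insubd (nil_bseq n _) (map inord (parts p)).

Definition intpart_decode (b : {bseq n of 'I_n.+1}) : option (intpart n) :=
  insub (map val b).

Lemma mem_leq_sumn (s : seq nat) i : i \in s -> (i <= sumn s)%N.
Proof.
elim: s => //= a s IHs; rewrite inE => /orP[/eqP->|/IHs]; first exact: leq_addr.
by move/leq_trans; apply; exact: leq_addl.
Qed.

Lemma size_leq_sumn (s : seq nat) : 0%N \notin s -> (size s <= sumn s)%N.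
Proof.
elim: s => //= a s IHs; rewrite inE negb_or => /andP[a_neq0 /IHs].
by move=> le_s; rewrite -add1n leq_add // lt0n eq_sym.
Qed.

Lemma intpart_codeK : pcancel intpart_code intpart_decode.
Proof.
case=> s s_part; have /and3P[_ s_pos /eqP s_sum] := s_part.
have le_s : (size s <= n)%N by have := size_leq_sumn s_pos; rewrite s_sum.
rewrite /intpart_code /intpart_decode /= val_insubd size_map le_s.
rewrite -map_comp map_id_in; first by rewrite insubT.
by move=> i /mem_leq_sumn; rewrite s_sum => le_i; rewrite /= inordK.
Qed.

HB.instance Definition _ : isFinite (intpart n) := PCanIsFinite intpart_codeK.

End IntpartFin.

Definition dominates (la mu : seq nat) : bool :=
  all (fun k => sumn (take k mu) <= sumn (take k la))%N
      (iota 0 (sumn la).+1).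

Definition is_ssyt (nu : seq nat) (T : seq (seq nat)) : bool :=
  [&& shape T == nu,
      all (sorted leq) T &
      all (fun i =>
        all (fun j => nth 0 (nth [::] T i) j < nth 0 (nth [::] T i.+1) j)%N
            (iota 0 (size (nth [::] T i.+1))))
        (iota 0 (size T))].

(* Does column j >= 1 of the skew shape al / be contain a box? *)
Definition skew_col (al be : seq nat) (j : nat) : bool :=
  has (fun i => nth 0 be i < j <= nth 0 al i)%N (iota 0 (size al)).

(* Column j.+1 can contain a box only if j < al_1, whence the bound. *)
Definition psi_skew (al be : seq nat) : {poly int} :=
  \prod_(1 <= j < head 0%N al | ~~ skew_col al be j && skew_col al be j.+1)
    (1 - 'X ^+ count_mem j be).

Definition subshape (T : seq (seq nat)) (a : nat) : seq nat :=
  [seq k <- [seq count (fun c => c <= a)%N row | row <- T] | (0 < k)%N].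

Definition ssyt_chain (T : seq (seq nat)) : seq (seq nat) :=
  [::] :: [seq subshape T a | a <- sort leq (undup (flatten T))].

Definition psi (T : seq (seq nat)) : {poly int} :=
  \prod_(i < (size (ssyt_chain T)).-1)
    psi_skew (nth [::] (ssyt_chain T) i.+1) (nth [::] (ssyt_chain T) i).

(* A symmetric function in infinitely many variables is given by its
   restrictions to N variables for all N; identities between symmetric
   functions are stated as identities for every N. *)

Definition monomial_sym (R : nzRingType) (n N : nat) (mu : intpart n) :
    {mpoly R[N]} :=
  \sum_(m : 'X_{1..N < n.+1} | perm_eq [seq k <- bmnm m | (0 < k)%N] mu)
    'X_[bmnm m].

Notation "x %:F" := (@FracField.tofrac _ x) : ring_scope.

Definition hlfrac (N : nat) : fieldType := {fraction {mpoly {poly int}[N]}}.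

Definition hlt (N : nat) : hlfrac N := ('X : {poly int})%:MP%:F.
Definition hlx (N : nat) (i : 'I_N) : hlfrac N := ('X_i)%:F.

Definition hl_v (N m : nat) : hlfrac N :=
  \prod_(1 <= i < m.+1) ((1 - hlt N ^+ i) / (1 - hlt N)).

(* v_la(t) = prod_(j >= 0) v_{m_j(la)}(t), where la is padded with zeros to
   length N, so that m_0(la) = N - l(la). *)
Definition hl_vpart (N : nat) (la : seq nat) : hlfrac N :=
  \prod_(0 <= j < (sumn la).+1) hl_v N #|[set i : 'I_N | nth 0%N la i == j]|.

(* The Hall-Littlewood polynomial P_la(x_1, ..., x_N; t), as defined in
   Macdonald, "Symmetric functions and Hall polynomials", III.2. *)
Definition HL (N : nat) (la : seq nat) : hlfrac N :=
  if (size la <= N)%N then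
    (hl_vpart N la)^-1 *
    \sum_(w : 'S_N)
      ((\prod_(i < N) hlx (w i) ^+ nth 0%N la i) *
       \prod_(i < N) \prod_(j < N | (i < j)%N)
         ((hlx (w i) - hlt N * hlx (w j)) / (hlx (w i) - hlx (w j))))
  else 0.

Definition is_hl_monomial_expansion (n : nat) (la : intpart n)
    (c : intpart n -> {poly int}) : Prop :=
  forall N, HL N la =
    (\sum_(mu : intpart n | dominates la mu) c mu *: monomial_sym _ N mu)%:F.

(* c_{la mu}(t), meaningful for mu <= la only. *)
Definition hl_monomial_coef (n : nat) (la : intpart n) :
    intpart n -> {poly int} :=
  epsilon (inhabits (fun _ => 0)) (is_hl_monomial_expansion la).

Definition is_hl_product_expansion (n : nat) (mu nu : seq nat)
    (c : intpart n -> {poly int}) : Prop :=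
  forall N, HL N mu * HL N nu = \sum_(la : intpart n) (c la)%:MP%:F * HL N la.

(* c_{mu nu}^la(t) = [P_la] (P_mu P_nu). *)
Definition hl_coef (n : nat) (mu nu : seq nat) : intpart n -> {poly int} :=
  epsilon (inhabits (fun _ => 0)) (is_hl_product_expansion mu nu).

(* The Schur polynomial s_la(x_1, ..., x_N).  A filling of the shape la by
   'I_N is recorded by its row reading word w. *)
Definition schur (N : nat) (la : seq nat) : {mpoly int[N]} :=
  \sum_(w : (sumn la).-tuple 'I_N | is_ssyt la (reshape la (map val w)))
    \prod_(i <- w) 'X_i.

Definition is_schur_product_expansion (n : nat) (mu nu : seq nat)
    (c : intpart n -> int) : Prop :=
  forall N, schur N mu * schur N nu = \sum_(la : intpart n) c la *: schur N la.

Definition lr_coef (n : nat) (mu nu : seq nat) : intpart n -> int :=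
  epsilon (inhabits (fun _ => 0)) (is_schur_product_expansion mu nu).

(* A series is given by the coefficient of each word. *)
Definition ncseries (R : Type) := seq nat -> R.

Definition ncmul (R : nzRingType) (F G : ncseries R) : ncseries R :=
  fun w => \sum_(0 <= k < (size w).+1) F (take k w) * G (drop k w).

Definition word_act (n : nat) (d : 'S_n) (w : seq nat) : seq nat :=
  [seq nth 0%N w ((d^-1)%g i) | i : 'I_n].

(* The linear extension of [word_act] to series of degree n: the coefficient
   of w in d o F is the coefficient in F of the word d^-1 o w, which d maps
   to w. *)
Definition ncact (R : nzRingType) (n : nat) (d : 'S_n) (F : ncseries R) :
    ncseries R :=
  fun w => if size w == n then F (word_act (d^-1)%g w) else 0.

(* The products (i_r n) ... (i_1 n-r+1) composed from right to left, where the
   transposition (i_k n-r+k) is tperm (f j) j for j = n-r+k-1 counted from 0.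
   The product of permutations in MathComp is composed from left to right, so
   that the factors are listed here by increasing j. *)
Definition star_perms (r n : nat) : {set 'S_n} :=
  [set (\prod_(j < n | (n - r <= j)%N) tperm (f j) j)%g
     | f : {ffun 'I_n -> 'I_n} & [forall j, (f j <= j)%N]].

Definition star (R : nzRingType) (r n : nat) (F G : ncseries R) : ncseries R :=
  fun w => \sum_(d in star_perms r n) ncact (d^-1)%g (ncmul F G) w.

Definition nc_monomial (R : nzRingType) (n : nat) (s : {set {set 'I_n}}) :
    ncseries R :=
  fun w =>
    if (size w == n) &&
       [forall a : 'I_n, forall b : 'I_n,
          (nth 0%N w a == nth 0%N w b) ==
          [exists B in s, (a \in B) && (b \in B)]]
    then 1 else 0.

Definition setpart_type (n : nat) (s : {set {set 'I_n}}) : seq nat :=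
  sort geq (map (fun B : {set 'I_n} => #|B|) (enum s)).

Definition part_fact (mu : seq nat) : nat := \prod_(k <- mu) k`!.

Definition liftedHL (n : nat) (la : intpart n) : ncseries {poly int} :=
  fun w =>
    \sum_(mu : intpart n | dominates la mu)
      (part_fact mu)%:R * hl_monomial_coef la mu *
      \sum_(s : {set {set 'I_n}} |
              partition s [set: 'I_n] && (setpart_type s == mu))
        nc_monomial _ s w.

(* The tableau of shape nu whose row reading word is w, if any, is
   [reshape nu w]; see [ssyt_reshape]. *)
Definition nonliftedHL (nu : seq nat) : ncseries {poly int} :=
  fun w =>
    let T := reshape nu w in
    if is_ssyt nu T && (flatten T == w) then psi T else 0.

Lemma ssyt_reshape (nu : seq nat) (T : seq (seq nat)) (w : seq nat) :
  is_ssyt nu T -> flatten T = w -> T = reshape nu w.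
Proof. by case/and3P=> /eqP <- _ _ <-; rewrite flattenK. Qed.

Definition nc_at0 (F : ncseries {poly int}) : ncseries int :=
  fun w => (F w).[0].

Definition liftedSchur (n : nat) (la : intpart n) : ncseries int :=
  nc_at0 (liftedHL la).

Definition nonliftedSchur (nu : seq nat) : ncseries int :=
  nc_at0 (nonliftedHL nu).

(* Main.v *)
(* Let R_la(x) be the unnormalized symmetrization defining P_la, built from the
   operators T_a G(X) = sum_x x^a prod_(y in X - x) (x - t y)/(x - y) G(X - x),
   and let z be a further variable.  One has
     T_a^m G(z, X) = T_a^m [G(z, -)](X) + (1 + t + ... + t^(m-1)) T_a^(m-1) D_a G(X)
   with an explicit defect operator D_a satisfying D_a T_a = t T_a D_a, and for
   b < a, D_a is expressed by D_b and by the T_c with b < c < a.  Lowering the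
   top group of equal rows of la in this way gives, by induction on the largest
   part, the branching rule P_la(z, X) = sum_mu psi_(la/mu) z^|la/mu| P_mu(X),
   hence the tableau formula for P_la.  It makes P_la the commutative image of
   the non-lifted function, shows that its monomial expansion is unitriangular
   over Z[t] and independent of the number of variables, and gives Schur
   functions at t = 0.

   For the star product, every permutation factors uniquely as an element of
   S_(r,n) and one of S_(n-r), on either side since S_(r,n) is stable under
   conjugation by S_(n-r).  Hence (n-r)! (F * G) is the sum of all place
   permutations of FG when F is invariant under place permutations.  A series
   that is invariant under place permutations is determined by its commutative
   image, and the commutative image of the lifted P_la is n! P_la, so both sides
   of the identity have image n! P_mu P_nu. *)
From Stdlib Require Import ClassicalEpsilon.
Require Import Defs.
From mathcomp Require Import all_boot all_order all_fingroup all_algebra.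
From mathcomp Require Import mpoly ring zify.
Import GRing.Theory.
Local Open Scope ring_scope.

Set Implicit Arguments.
Unset Strict Implicit.
Unset Printing Implicit Defensive.

(** * Symmetrization operators *)

(** Everything rests on the splitting (x - t z)/(x - z) = 1 + (1 - t) z/(x - z), which isolates what
    a new variable z adds to one symmetrization step. This is the source of the defect operator.
    Carrying it past k copies of [hl_op a] costs t^k, so m equal rows produce the q-integer
    [qint t m]; the same q-integers are the factors of the normalization of P_la. The individual
    summands of the symmetrization have denominators that cancel only in the total; operators on
    lists of distinct field elements, removing one variable at a time, allow an induction without
    clearing them. A second obstacle is that the coefficients in the statement are chosen by
    [epsilon]. They are usable only once a witness over Z[t], valid for all N at once, is produced,
    and at t = 0 they must be matched with a second such choice, which takes linear independence of
    the Schur polynomials. For the star product, place invariance is not visible on the sum over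
    S_(r,n); it is visible after multiplication by (n-r)!, which is harmless because Z[t] has no
    torsion. *)

Section SymmetrizationOperators.
Variables (F : fieldType) (t : F).
Implicit Types (x y z : F) (xs : seq F) (G : seq F -> F).

Definition hl_kernel x xs := \prod_(y <- xs) ((x - t * y) / (x - y)).

Definition hl_op a G xs :=
  \sum_(x <- xs) x ^+ a * hl_kernel x (rem x xs) * G (rem x xs).

(** What z adds to [hl_op a G (z :: xs)] beyond being a parameter of G: the part (1 - t) z/(x - z)
    of the factor (x - t z)/(x - z) for each x in xs, and the summand that removes z. *)
Definition hl_defect z a G xs :=
  (1 - t) * (\sum_(x <- xs)
     x ^+ a * (z / (x - z)) * hl_kernel x (rem x xs) * G (z :: rem x xs)) +
  z ^+ a * hl_kernel z xs * G xs.

Definition qint m : F := \sum_(i < m) t ^+ i.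

(* Only the nonzero rows of la are placed, so that this is Macdonald's R_la
   divided by v_{m_0}; see [hl_R_pad0]. *)
Fixpoint hl_R (la : seq nat) : seq F -> F :=
  if la is a :: la' then hl_op a (hl_R la') else fun=> 1.

Lemma mul_qint m : (1 - t) * qint m = 1 - t ^+ m.
Proof.
rewrite -[in RHS](expr1n F m) subrXX; congr (_ * _).
by apply: eq_bigr => i _; rewrite expr1n mul1r.
Qed.

Lemma qintS m : qint m.+1 = 1 + t * qint m.
Proof.
rewrite /qint big_ord_recl mulr_sumr; congr (_ + _).
by apply: eq_bigr => i _; rewrite exprS.
Qed.

Lemma qintSr m : qint m.+1 = qint m + t ^+ m.
Proof. by rewrite /qint big_ord_recr. Qed.

Lemma hl_kernel_perm x xs ys : perm_eq xs ys -> hl_kernel x xs = hl_kernel x ys.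
Proof. exact: perm_big. Qed.

Lemma hl_kernel_rem x y xs : y \in xs ->
  hl_kernel x xs = (x - t * y) / (x - y) * hl_kernel x (rem y xs).
Proof. by move/perm_to_rem/(hl_kernel_perm x)->; rewrite /hl_kernel big_cons. Qed.

Lemma eq_hl_op a G1 G2 xs :
  (forall x, x \in xs -> G1 (rem x xs) = G2 (rem x xs)) ->
  hl_op a G1 xs = hl_op a G2 xs.
Proof. by move=> eqG; apply: eq_big_seq => x /eqG->. Qed.

Lemma uniq_cons_rem z x xs : uniq (z :: xs) -> uniq (z :: rem x xs).
Proof.
rewrite /= => /andP[zxs Uxs]; rewrite rem_uniq // andbT.
by apply: contra zxs; apply: mem_rem.
Qed.

Lemma eq_iter_hl_op z a m G1 G2 xs : uniq (z :: xs) ->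
  (forall ys, uniq (z :: ys) -> G1 ys = G2 ys) ->
  iter m (hl_op a) G1 xs = iter m (hl_op a) G2 xs.
Proof.
move=> Uxs eqG; elim: m xs Uxs => [|m IHm] xs Uxs /=; first exact: eqG.
by apply: eq_hl_op => x _; apply: IHm; apply: uniq_cons_rem.
Qed.

Lemma hl_opD a G1 G2 xs :
  hl_op a (fun ys => G1 ys + G2 ys) xs = hl_op a G1 xs + hl_op a G2 xs.
Proof. by rewrite /hl_op -big_split; apply: eq_bigr => x _; rewrite mulrDr. Qed.

Lemma hl_opZ a c G xs :
  hl_op a (fun ys => c * G ys) xs = c * hl_op a G xs.
Proof. by rewrite /hl_op mulr_sumr; apply: eq_bigr => x _; rewrite mulrCA. Qed.

Lemma hl_op_sum (I : Type) (r : seq I) (P : pred I) a (G : I -> seq F -> F) xs :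
  hl_op a (fun ys => \sum_(i <- r | P i) G i ys) xs =
  \sum_(i <- r | P i) hl_op a (G i) xs.
Proof.
rewrite /hl_op exchange_big; apply: eq_bigr => x _; exact: mulr_sumr.
Qed.

Lemma iter_hl_opD a m G1 G2 xs :
  iter m (hl_op a) (fun ys => G1 ys + G2 ys) xs =
  iter m (hl_op a) G1 xs + iter m (hl_op a) G2 xs.
Proof.
elim: m xs => //= m IHm xs; rewrite -hl_opD.
by apply: eq_hl_op => x _; apply: IHm.
Qed.

Lemma iter_hl_opZ a m c G xs :
  iter m (hl_op a) (fun ys => c * G ys) xs = c * iter m (hl_op a) G xs.
Proof.
elim: m xs => //= m IHm xs; rewrite -hl_opZ.
by apply: eq_hl_op => x _; apply: IHm.
Qed.

Lemma iter_hl_op_sum (I : Type) (r : seq I) (P : pred I) a m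
    (G : I -> seq F -> F) xs :
  iter m (hl_op a) (fun ys => \sum_(i <- r | P i) G i ys) xs =
  \sum_(i <- r | P i) iter m (hl_op a) (G i) xs.
Proof.
elim: m xs => //= m IHm xs; rewrite -hl_op_sum.
by apply: eq_hl_op => x _; apply: IHm.
Qed.

Lemma hl_op_cons z a G xs : uniq (z :: xs) ->
  hl_op a G (z :: xs) = hl_op a (fun ys => G (z :: ys)) xs + hl_defect z a G xs.
Proof.
case/andP=> zxs Uxs; rewrite /hl_op /hl_defect big_cons /= eqxx addrA [RHS]addrC.
congr (_ + _); rewrite mulr_sumr -big_split; apply: eq_big_seq => x xxs /=.
have zx : z != x by apply: contraNneq zxs => ->.
rewrite (negPf zx) /hl_kernel big_cons.
by field; rewrite subr_eq0 eq_sym.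
Qed.

Lemma remC (s : seq F) x y : uniq s -> rem x (rem y s) = rem y (rem x s).
Proof.
move=> Us; rewrite ![rem _ (rem _ s)]rem_filter ?rem_uniq // !rem_filter //.
by rewrite -!filter_predI; apply: eq_filter => u /=; rewrite andbC.
Qed.

Lemma sum_rem_swap (s : seq F) (f : F -> F -> F) : uniq s ->
  \sum_(x <- s) \sum_(y <- rem x s) f x y =
  \sum_(x <- s) \sum_(y <- rem x s) f y x.
Proof.
move=> Us.
have E g : \sum_(x <- s) \sum_(y <- rem x s) g x y =
           \sum_(x <- s) \sum_(y <- s | y != x) g x y :> F.
  by apply: eq_bigr => x _; rewrite rem_filter // big_filter.
rewrite !E (exchange_big_dep predT) //=; apply: eq_bigr => x _.
by apply: eq_bigl => y; rewrite eq_sym.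
Qed.

(* The (x, y) and (y, x) terms only agree after symmetrization; the difference
   of the two summands is S / (x - y) with S symmetric, i.e. [h x y - h y x]
   for [h x y = S * x / (x - y) ^+ 2]. *)
Lemma hl_defect_op z a G xs : uniq (z :: xs) ->
  hl_defect z a (hl_op a G) xs = t * hl_op a (hl_defect z a G) xs.
Proof.
move=> Uzxs; have /andP[zxs Uxs] := Uzxs.
have nz x : x \in xs -> x - z != 0.
  by move=> xxs; rewrite subr_eq0; apply: contraNneq zxs => <-.
have nxy x y : y \in rem x xs -> x - y != 0.
  by rewrite mem_rem_uniq // inE subr_eq0 eq_sym => /andP[].
pose rr x y := rem y (rem x xs).
pose C (x y : F) : F := x ^+ a * y ^+ a * hl_kernel x (rr x y) * hl_kernel y (rr x y) *
  G (z :: rr x y).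
have CC x y : C x y = C y x.
  by rewrite /C /rr (remC _ _ Uxs); ring.
pose f (x y : F) : F := (1 - t) * (z / (x - z)) * ((x - t * y) / (x - y)) *
              (1 + (1 - t) * (z / (y - z))).
pose g (x y : F) : F := t * ((x - t * y) / (x - y)) * ((1 - t) * (z / (y - z))).
pose h (x y : F) : F := (1 - t) * z / ((x - z) * (y - z)) * (x - t * y) * (y - t * x) *
  x / (x - y) ^+ 2.
(* The terms in which both x and z are removed. *)
pose L (x : F) : F := x ^+ a * hl_kernel x (rem x xs) * (z ^+ a) *
   hl_kernel z (rem x xs) * G (rem x xs).
have -> : t * hl_op a (hl_defect z a G) xs =
    (\sum_(x <- xs) \sum_(y <- rem x xs) g x y * C x y) +
    \sum_(x <- xs) t * L x.
  rewrite /hl_op mulr_sumr -big_split; apply: eq_big_seq => x xxs /=.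
  rewrite /hl_defect mulrDr mulrDr; congr (_ + _); last by rewrite /L; ring.
  rewrite !mulr_sumr; apply: eq_big_seq => y yxs.
  by rewrite (hl_kernel_rem x yxs) /g /C /rr; ring.
have -> : hl_defect z a (hl_op a G) xs =
    (\sum_(x <- xs) \sum_(y <- rem x xs) f x y * C x y) +
    \sum_(x <- xs) t * L x.
  rewrite /hl_defect mulr_sumr [X in _ + X]mulr_sumr -!big_split.
  apply: eq_big_seq => x xxs /=.
  rewrite hl_op_cons ?uniq_cons_rem // /hl_defect.
  rewrite (hl_kernel_rem z xxs).
  transitivity ((1 - t) * (x ^+ a * (z / (x - z)) * hl_kernel x (rem x xs)) *
    ((hl_op a (fun ys => G (z :: ys)) (rem x xs)) + (1 - t) *
    (\sum_(x0 <- rem x xs) x0 ^+ a * (z / (x0 - z)) *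
       hl_kernel x0 (rem x0 (rem x xs)) * G (z :: rem x0 (rem x xs))))
     + t * L x).
    (* The coefficients of the terms [L x] add up by (1 - t) z/(x - z) + (z - t x)/(z - x) = t. *)
    by rewrite /L; field; rewrite nz // -oppr_eq0 opprB nz.
  congr (_ + _); rewrite /hl_op mulrDr !mulr_sumr -big_split.
  apply: eq_big_seq => y yxs /=.
  by rewrite (hl_kernel_rem x yxs) /f /C /rr; ring.
congr (_ + _); apply/eqP; rewrite -subr_eq0; apply/eqP.
transitivity (\sum_(x <- xs) \sum_(y <- rem x xs) h x y * C x y -
   \sum_(x <- xs) \sum_(y <- rem x xs) h y x * C y x); last first.
  by rewrite [X in _ - X]sum_rem_swap // subrr.
rewrite -!sumrB; apply: eq_big_seq => x xxs.
rewrite -!sumrB; apply: eq_big_seq => y yxs.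
rewrite (CC y x) -!mulrBl; congr (_ * _).
rewrite /f /g /h; field.
by rewrite -[y - x]opprB oppr_eq0 nxy // !nz // (mem_rem yxs).
Qed.

(** Any one of the m operators can emit the defect. Moving it past the k operators inside gives t^k,
    and the sum over k < m is [qint m]. *)
Lemma iter_hl_op_cons z a m G xs : uniq (z :: xs) ->
  iter m (hl_op a) G (z :: xs) =
  iter m (hl_op a) (fun ys => G (z :: ys)) xs +
  qint m * iter m.-1 (hl_op a) (hl_defect z a G) xs.
Proof.
have defect_iter k ys : uniq (z :: ys) ->
    hl_defect z a (iter k (hl_op a) G) ys =
    t ^+ k * iter k (hl_op a) (hl_defect z a G) ys.
  elim: k ys => [|k IHk] ys Uys /=; first by rewrite mul1r.
  rewrite hl_defect_op // exprS -mulrA; congr (_ * _).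
  rewrite -hl_opZ; apply: eq_hl_op => x _; apply: IHk; exact: uniq_cons_rem.
elim: m xs => [|m IHm] xs Uxs; first by rewrite /qint big_ord0 mul0r addr0.
rewrite iterS hl_op_cons // defect_iter // qintSr mulrDl [RHS]addrA /=.
congr (_ + _).
have -> : hl_op a (fun ys => iter m (hl_op a) G (z :: ys)) xs =
   hl_op a (fun ys => iter m (hl_op a) (fun ys => G (z :: ys)) ys +
     qint m * iter m.-1 (hl_op a) (hl_defect z a G) ys) xs.
  by apply: eq_hl_op => x _; apply: IHm; apply: uniq_cons_rem.
rewrite hl_opD hl_opZ; congr (_ + _).
(* For m = 0 the value [m.-1] is a default, multiplied by [qint 0], which is 0. *)
by case: m {IHm} => //=; rewrite /qint big_ord0 !mul0r.
Qed.

(** The geometric sum for (x^a - z^(a-b) x^b)/(x - z) turns D_a into z^(a-b) D_b plus multiples of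
    T_c for b <= c < a. Writing D_b as T_b G(z, X) - T_b [G(z, -)](X), its coefficient -1 and the 1
    - t of the term c = b combine to -t. *)
Lemma hl_defect_lower z a b G xs : uniq (z :: xs) -> (b < a)%N ->
  hl_defect z a G xs =
  z ^+ (a - b) * (hl_op b G (z :: xs) - t * hl_op b (fun ys => G (z :: ys)) xs)
  + (1 - t) * (\sum_(b.+1 <= c < a) z ^+ (a - c) *
                 hl_op c (fun ys => G (z :: ys)) xs).
Proof.
move=> Uzxs ltba; have /andP[zxs _] := Uzxs.
have nz x : x \in xs -> x - z != 0.
  by move=> xxs; rewrite subr_eq0; apply: contraNneq zxs => <-.
have geom x : x \in xs -> x ^+ a * (z / (x - z)) =
    z ^+ (a - b) * (x ^+ b * (z / (x - z))) +
    \sum_(b <= c < a) z ^+ (a - c) * x ^+ c.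
  move=> xxs; have nxz := nz x xxs.
  have [d ->] : exists d, a = (d + b)%N by exists (a - b)%N; rewrite subnK // ltnW.
  rewrite addnK; elim: d => [|d IHd].
    by rewrite add0n big_geq // mul1r addr0.
  rewrite addSn big_nat_recr ?leq_addl //= exprS -mulrA IHd subSnn expr1.
  have -> : \sum_(b <= i < d + b) z ^+ ((d + b).+1 - i) * x ^+ i =
    z * (\sum_(b <= i < d + b) z ^+ (d + b - i) * x ^+ i).
    rewrite mulr_sumr big_nat_cond [RHS]big_nat_cond.
    apply: eq_bigr => i /andP[/andP[_ lti] _].
    by rewrite subSn ?(ltnW lti) // exprS mulrA.
  have := IHd; set S := \sum_(_ <= i < _) _ => {}IHd.
  have -> : S = x ^+ (d + b) * (z / (x - z)) -
            z ^+ d * (x ^+ b * (z / (x - z))).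
    by rewrite IHd addrC addKr.
  by rewrite !exprD exprS; field.
have := hl_op_cons b G Uzxs => ->.
rewrite /hl_defect.
have -> : \sum_(x <- xs) x ^+ a * (z / (x - z)) * hl_kernel x (rem x xs) *
    G (z :: rem x xs) =
  z ^+ (a - b) * (\sum_(x <- xs) x ^+ b * (z / (x - z)) *
    hl_kernel x (rem x xs) * G (z :: rem x xs)) +
  \sum_(b <= c < a) z ^+ (a - c) * hl_op c (fun ys => G (z :: ys)) xs.
  under [X in _ = _ + X]eq_bigr => c _ do rewrite /hl_op mulr_sumr.
  rewrite exchange_big mulr_sumr -big_split; apply: eq_big_seq => x xxs /=.
  rewrite geom // !mulrDl; congr (_ + _); first by rewrite !mulrA.
  by rewrite !mulr_suml; apply: eq_bigr => c _; rewrite !mulrA.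
rewrite big_ltn //.
have -> : z ^+ a = z ^+ (a - b) * z ^+ b by rewrite -exprD subnK // ltnW.
by ring.
Qed.

(** Partial fractions in z. With z/(z - x) in place of 1/(z - x), the constant is the value at z =
    0, namely t^|X|. *)
Lemma hl_kernel_partial_fraction z xs : uniq (z :: xs) ->
  hl_kernel z xs = t ^+ size xs +
    (1 - t) * (\sum_(x <- xs) z / (z - x) * hl_kernel x (rem x xs)).
Proof.
elim: xs z => [|x xs IHxs] z; first by rewrite /hl_kernel !big_nil mulr0 addr0.
move=> Uzx; have /and3P[] := Uzx; rewrite inE negb_or => /andP[zx zxs] xxs Uxs.
have nxz : z - x != 0 by rewrite subr_eq0.
rewrite {1}/hl_kernel big_cons -/(hl_kernel z xs) IHxs /= ?zxs // big_cons eqxx.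
rewrite (IHxs x) /= ?xxs //.
have -> : \sum_(j <- xs) z / (z - j) *
     hl_kernel j (if x == j then xs else x :: rem j xs) =
   \sum_(j <- xs) (z - t * x) / (z - x) * (z / (z - j)) * hl_kernel j (rem j xs)
   - \sum_(j <- xs) z / (z - x) * (1 - t) *
       (x / (x - j) * hl_kernel j (rem j xs)).
  rewrite -sumrB; apply: eq_big_seq => j jxs.
  have xj : x != j by apply: contraNneq xxs => ->.
  have zj : z != j by apply: contraNneq zxs => ->.
  rewrite (negPf xj) /hl_kernel big_cons.
  by field; rewrite nxz !subr_eq0 xj zj eq_sym xj.
rewrite -mulr_sumr; under [X in _ = _ + _ * (_ + (X - _))]eq_bigr => j _ do
  rewrite -mulrA.
by rewrite -mulr_sumr exprS; field.
Qed.

(** Adding z contributes its defect; there the sum over x cancels against the partial fractions of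
    [hl_kernel z xs], and t^|X| is left. *)
Lemma hl_op0_1 xs : uniq xs -> hl_op 0 (fun=> 1) xs = qint (size xs).
Proof.
elim: xs => [|z xs IHxs] Uzxs; first by rewrite /hl_op /qint big_nil big_ord0.
have /andP[zxs Uxs] := Uzxs.
rewrite hl_op_cons // IHxs // /= qintSr; congr (_ + _).
rewrite /hl_defect (hl_kernel_partial_fraction Uzxs) !mul1r mulr1 addrCA.
rewrite -mulrDr -big_split big1_seq ?mulr0 ?addr0 // => x /andP[_ xxs] /=.
have zx : z != x by apply: contraNneq zxs => ->.
by rewrite expr0; field; rewrite !subr_eq0 zx eq_sym zx.
Qed.

Lemma hl_R_perm la xs ys : perm_eq xs ys -> hl_R la xs = hl_R la ys.
Proof.
elim: la xs ys => //= a la IHla xs ys eqxy; rewrite /hl_op (perm_big _ eqxy).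
apply: eq_big_seq => x xys.
have eqr : perm_eq (rem x xs) (rem x ys).
  rewrite -(perm_cons x).
  apply: perm_trans (perm_trans eqxy (perm_to_rem xys)).
  by rewrite perm_sym perm_to_rem // (perm_mem eqxy).
by rewrite (hl_kernel_perm x eqr) (IHla _ _ eqr).
Qed.

Lemma hl_R_cat_nseq a m la : hl_R (nseq m a ++ la) = iter m (hl_op a) (hl_R la).
Proof. by elim: m => //= m ->. Qed.

Lemma hl_R_gt_size la xs : (size xs < size la)%N -> hl_R la xs = 0.
Proof.
elim: la xs => //= a la IHla xs; rewrite ltnS => le_s.
rewrite /hl_op big1_seq // => x /andP[_ xxs].
by rewrite IHla ?mulr0 // size_rem //; case: xs xxs le_s.
Qed.

Lemma hl_R_nseq0 xs : uniq xs ->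
  hl_R (nseq (size xs) 0%N) xs = \prod_(i < size xs) qint i.+1.
Proof.
have [m] := ubnP (size xs); elim: m xs => // m IHm [|x xs] lt_m Uxs.
  by rewrite big_ord0.
rewrite [nseq _ _]/= big_ord_recr /=.
rewrite (@eq_hl_op _ _ (fun=> (\prod_(i < size xs) qint i.+1) * 1)).
  by rewrite hl_opZ hl_op0_1.
move=> y yxs; have sz : size (rem y (x :: xs)) = size xs by rewrite size_rem.
by rewrite mulr1 -[in LHS]sz IHm ?rem_uniq // sz.
Qed.

(** The extra product is v_(m_0)(t), where m_0 zero rows are needed to have one row per variable. *)
Lemma hl_R_pad0 la xs : uniq xs -> (size la <= size xs)%N ->
  hl_R (la ++ nseq (size xs - size la) 0%N) xs =
  hl_R la xs * \prod_(i < size xs - size la) qint i.+1.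
Proof.
elim: la xs => [|a la IHla] xs Uxs /=.
  by rewrite subn0 mul1r => _; apply: hl_R_nseq0.
move=> lt_la; rewrite mulrC -hl_opZ; apply: eq_hl_op => x xxs.
have sz : size (rem x xs) = (size xs).-1 by rewrite size_rem.
have e : (size xs - (size la).+1 = size (rem x xs) - size la)%N.
  by rewrite sz subnS predn_sub.
rewrite mulrC e IHla ?rem_uniq // sz.
by rewrite -ltnS prednK // (leq_trans _ lt_la).
Qed.

End SymmetrizationOperators.

(** * Branching rule *)

Definition ispart (la : seq nat) := sorted geq la && (0%N \notin la).

Lemma ispart_cons a la :
  ispart (a :: la) = [&& (0 < a)%N, (head 0 la <= a)%N & ispart la].
Proof.
rewrite /ispart inE negb_or eq_sym -lt0n /=.
case: la => [|b la] /=; first by rewrite andbT.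
by case: (0 < a)%N; case: (b <= a)%N; rewrite ?andbF.
Qed.

Lemma ispart_head0 la : ispart la -> (head 0 la == 0)%N = nilp la.
Proof. by case: la => //= a la; rewrite ispart_cons => /andP[/lt0n_neq0/negPf]. Qed.

Lemma ispart_nth_le la i : ispart la -> (nth 0 la i.+1 <= nth 0 la i)%N.
Proof.
elim: la i => [|a la IHla] [|i] //=; rewrite ispart_cons => /and3P[_ le_a pla].
  by rewrite nth0.
exact: IHla.
Qed.

Lemma ispart_mem_le la i : ispart la -> i \in la -> (i <= head 0 la)%N.
Proof.
elim: la => //= a la IHla; rewrite ispart_cons inE => /and3P[_ le_a pla].
by case/predU1P => [-> //|/IHla-/(_ pla)/leq_trans->].
Qed.

Lemma ispart_count_gt la i : ispart la -> (head 0 la < i)%N -> count_mem i la = 0%N.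
Proof.
by move=> pla lti; apply/count_memPn; apply: contraL lti => /(ispart_mem_le pla);
  rewrite leqNgt.
Qed.

(** * Horizontal strips *)

Definition cons_pos b (m : seq nat) := if b is 0 then m else b :: m.

(** All mu such that la / mu is a horizontal strip. [cons_pos] drops a row of length 0, which for a
    partition la can only be the last row, so that no zero parts appear. *)
Fixpoint strips (la : seq nat) : seq (seq nat) :=
  if la is a :: la' then
    [seq cons_pos b m | m <- strips la', b <- index_iota (head 0 la')%N a.+1]
  else [:: [::]].

Definition is_strip la m :=
  [&& ispart m, (size m <= size la)%N &
      [forall i : 'I_(size la), (nth 0 la i.+1 <= nth 0 m i <= nth 0 la i)%N]].

Lemma is_stripP la m :
  reflect [/\ ispart m, (size m <= size la)%N &
              forall i, (nth 0 la i.+1 <= nth 0 m i <= nth 0 la i)%N]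
          (is_strip la m).
Proof.
apply: (iffP and3P) => [][pm sm H]; split=> //.
  move=> i; have [lt_i|le_i] := ltnP i (size la).
    exact: (forallP H (Ordinal lt_i)).
  by rewrite !nth_default // ?(leq_trans sm) // ltnW.
by apply/forallP => i; apply: H.
Qed.

Lemma mem_strips la m : ispart la -> (m \in strips la) = is_strip la m.
Proof.
elim: la m => [|a la IHla] m pla.
  rewrite inE; apply/eqP/is_stripP => [->|[pm]].
    by split => // i; rewrite !nth_nil.
  by rewrite leqn0 => /nilP.
have := pla; rewrite ispart_cons => /and3P[a_gt0 le_a pla'].
apply/allpairsPdep/is_stripP => [[m' [b []]]|[pm sm H]].
  rewrite IHla // mem_index_iota ltnS => /is_stripP[pm' sm' H'] /andP[ge_b le_b].
  case: b ge_b le_b => [|b] ge_b le_b -> /=.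
    move: ge_b; rewrite leqn0 ispart_head0 // => /nilP la0.
    move: sm' H'; rewrite {}la0 leqn0 => /nilP-> _; split => // -[|i];
      by rewrite /= ?nth_nil.
  split=> //=.
    rewrite ispart_cons pm' /= andbT; apply: leq_trans ge_b.
    by have /andP[_] := H' 0%N; rewrite !nth0.
  by case=> [|i] /=; [rewrite nth0 ge_b | apply: H'].
have [m0|] := eqVneq m [::].
  have la0 : la = [::].
    apply/nilP; rewrite -ispart_head0 // -leqn0.
    by have /andP[] := H 0%N; rewrite /= m0 /= -nth0.
  by exists [::], 0%N; rewrite la0 m0.
case: m pm sm H => // b m; rewrite ispart_cons ltnS => /and3P[b0 le_b pm] sm H _.
exists m, b; split; [rewrite IHla //|rewrite mem_index_iota|by case: b b0 {le_b H}].
  by apply/is_stripP; split=> // i; apply: (H i.+1).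
by rewrite ltnS; have := H 0%N; rewrite /= nth0.
Qed.

Lemma cons_posE b m : (0 < b)%N -> cons_pos b m = b :: m.
Proof. by case: b. Qed.

Lemma uniq_strips la : ispart la -> uniq (strips la).
Proof.
elim: la => [|a la IHla] //; rewrite ispart_cons => /and3P[a_gt0 le_a pla].
apply: allpairs_uniq_dep => [||[m b] [m' b']]; first exact: IHla.
  by move=> m _; apply: iota_uniq.
have st_mem (p : {_ : seq nat & nat}) :
    p \in [seq existT (fun=> nat) m0 b0 | m0 <- strips la,
             b0 <- index_iota (head 0 la)%N a.+1] ->
    tag p \in strips la /\ (head 0 la <= tagged p)%N.
  by case/allpairsPdep => x [y [ix + ->]]; rewrite mem_index_iota => /andP[].
move=> /st_mem[im ge_b] /st_mem[im' ge_b'] /=.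
have [la0|la0] := posnP (head 0%N la).
  move/eqP: la0 im im'; rewrite ispart_head0 // => /nilP-> /=.
  by rewrite !inE => /eqP-> /eqP->; case: b b' {ge_b ge_b'} => [|b] [|b'] // [->].
by rewrite !cons_posE ?(leq_trans la0) // => -[-> ->].
Qed.

Lemma strips_ispart la m : ispart la -> m \in strips la -> ispart m.
Proof. by move=> pla; rewrite mem_strips // => /is_stripP[]. Qed.

Lemma strips_head la m : ispart la -> m \in strips la -> (head 0 m <= head 0 la)%N.
Proof.
by move=> pla; rewrite mem_strips // => /is_stripP[_ _ /(_ 0%N)/andP[_]]; rewrite !nth0.
Qed.

Lemma sumn_cons_pos b m : sumn (cons_pos b m) = (b + sumn m)%N.
Proof. by case: b. Qed.

Lemma strips_sumn la m : ispart la -> m \in strips la -> (sumn m <= sumn la)%N.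
Proof.
elim: la m => [|a la IHla] m; first by rewrite inE => _ /eqP->.
rewrite ispart_cons => /and3P[a_gt0 le_a pla] /allpairsPdep[m' [b [im' + ->]]].
rewrite mem_index_iota ltnS => /andP[_ le_b].
by rewrite sumn_cons_pos leq_add // IHla.
Qed.

(** * Columns of a strip and the weight psi *)

Lemma skew_colP la m j :
  reflect (exists2 i, (i < size la)%N & (nth 0 m i < j <= nth 0 la i)%N)
          (skew_col la m j).
Proof.
apply: (iffP hasP) => [[i]|[i lt_i H]]; last by exists i; rewrite ?mem_iota.
by rewrite mem_iota => /andP[_ lt_i] H; exists i.
Qed.

Lemma skew_col_cons a b la m j :
  skew_col (a :: la) (b :: m) j = (b < j <= a)%N || skew_col la m j.
Proof.
apply/skew_colP/orP => [[[|i] lt_i H]|[H|/skew_colP[i lt_i H]]].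
- by left.
- by right; apply/skew_colP; exists i.
- by exists 0%N.
- by exists i.+1.
Qed.

Lemma skew_col_gt_head la m j : ispart la -> (head 0 la < j)%N ->
  skew_col la m j = false.
Proof.
move=> pla ltj; apply/skew_colP => -[i lt_i /andP[_ le_j]].
have := ispart_mem_le pla (mem_nth 0%N lt_i).
by move/(leq_trans le_j); rewrite leqNgt ltj.
Qed.

(** Columns beyond the largest part are empty. A common bound M lets the products for [a :: la] and
    for la be compared. *)
Lemma psi_skewE M la m : ispart la -> (head 0 la <= M)%N ->
  psi_skew la m = \prod_(1 <= j < M | ~~ skew_col la m j && skew_col la m j.+1)
    (1 - 'X ^+ count_mem j m).
Proof.
move=> pla le_M; rewrite /psi_skew.
have [h0|h0] := posnP (head 0%N la).
  rewrite h0 big_geq // big_nat_cond big_pred0 // => j.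
  by rewrite (@skew_col_gt_head la m j.+1) ?andbF // h0.
rewrite [RHS](big_cat_nat h0 le_M) /= [X in _ = _ * X]big_nat_cond.
rewrite [X in _ = _ * X]big_pred0 ?mulr1 // => j.
have [le_j|//] := leqP (head 0%N la) j.
by rewrite (@skew_col_gt_head la m j.+1) ?andbF.
Qed.

(* Prepending a row only affects the column of the last box of the new row b. *)
Lemma psi_skew_cons a b la m : ispart (a :: la) -> m \in strips la ->
    (head 0 la <= b <= a)%N ->
  psi_skew (a :: la) (cons_pos b m) = psi_skew la m *
    (if (0 < b < a)%N && ~~ skew_col la m b
     then 1 - 'X ^+ (count_mem b m).+1 else 1).
Proof.
move=> pala im /andP[ge_b le_b].
have := pala; rewrite ispart_cons => /and3P[a_gt0 le_a pla].
case: b ge_b le_b => [|b] ge_b le_b.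
  move: ge_b im; rewrite leqn0 ispart_head0 // => /nilP->; rewrite inE => /eqP-> /=.
  rewrite mulr1; transitivity (1 : {poly int}); last by rewrite /psi_skew big_geq.
  rewrite (@psi_skewE a [:: a]) ?ispart_cons ?a_gt0 //.
  rewrite big_nat_cond big_pred0 // => j.
  case: j => [|j] //=; rewrite /skew_col /= !orbF; case: (ltnP j a) => [|ge_j] /=.
    by rewrite andbF.
  by rewrite ltnNge (leq_trans ge_j).
rewrite cons_posE //; set c := b.+1 in ge_b le_b *.
rewrite (psi_skewE _ pla ge_b) (@psi_skewE a) // (@big_cat_nat _ _ _ c) //=.
congr (_ * _).
  rewrite big_nat_cond [RHS]big_nat_cond; apply: eq_big => j.
    rewrite !skew_col_cons ltnS.
    case: (ltnP j c) => [lt_j|]; last by rewrite !andbF.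
    by rewrite (leq_gtF (ltnW lt_j)).
  by case/andP=> /andP[_ lt_j] _ /=; rewrite (gtn_eqF lt_j).
case: (ltnP c a) => [lt_c|ge_c]; last by rewrite big_geq.
rewrite big_ltn_cond // [X in if _ then _ * X else X]big_nat_cond.
rewrite big_pred0 => [|j].
  rewrite !skew_col_cons ltnn leqnn lt_c /= andbT eqxx add1n.
  by case: (skew_col la m c); rewrite //= mulr1.
by rewrite skew_col_cons; case: (ltnP c j) => //= _; case: (ltnP j a) => //= /ltnW->.
Qed.

(** Removing a horizontal strip can shorten only the lowest of the rows of maximal length, and does
    so exactly when the strip has a box in that column. This separates the two cases of the weight
    in [hl_R_branch]. *)
Lemma strips_count_head la m : ispart la -> m \in strips la -> (0 < head 0 la)%N ->
  count_mem (head 0 la)%N la = (skew_col la m (head 0 la) + count_mem (head 0 la)%N m)%N.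
Proof.
elim: la m => [|a la IHla] m //= pala /allpairsPdep[m' [b [im ib ->]]] a_gt0.
move: ib; rewrite mem_index_iota ltnS => /andP[ge_b le_b].
have := pala; rewrite ispart_cons => /and3P[_ le_a pla].
rewrite eqxx; have [ea|na] := eqVneq (head 0%N la) a.
  have eb : b = a by apply/eqP; rewrite eqn_leq le_b -ea.
  rewrite eb cons_posE //= skew_col_cons ltnn /= eqxx.
  by have := IHla _ pla im; rewrite ea => ->; rewrite // addnCA.
have lt_a : (head 0 la < a)%N by rewrite ltn_neqAle na.
rewrite ispart_count_gt //.
have m'0 : count_mem a m' = 0%N.
  by apply: ispart_count_gt (strips_ispart pla im) (leq_ltn_trans (strips_head pla im) lt_a).
have [la0|la0] := posnP (head 0%N la).
  move/eqP: la0 im; rewrite ispart_head0 // => /nilP->; rewrite inE => /eqP->.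
  case: b {ge_b} le_b => [|b] le_b; first by rewrite /skew_col /= leqnn a_gt0.
  rewrite cons_posE // skew_col_cons /= leqnn andbT orbF addn0.
    by rewrite addn0; case: (ltngtP b.+1 a) le_b.
rewrite cons_posE ?(leq_trans la0) // skew_col_cons skew_col_gt_head // leqnn andbT orbF /=.
by rewrite m'0 !addn0; case: (ltngtP b a) le_b.
Qed.

Lemma psi_skew_nil : psi_skew [::] [::] = 1.
Proof. by rewrite /psi_skew big_geq. Qed.

(** * Branching of the symmetrized sums R_la *)

Section Branching.
Variables (F : fieldType) (phi : {rmorphism {poly int} -> F}).
Let t := phi 'X.
Hypothesis qint_neq0 : forall m, qint t m.+1 != 0.
Implicit Types (x y z : F) (xs : seq F).

(** The product of v_(m_j)(t) over j >= 1, accumulated row by row: a row with k equal rows below it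
    contributes the q-integer [k+1]. *)
Fixpoint hl_norm (la : seq nat) : F :=
  if la is a :: la' then qint t (count_mem a la').+1 * hl_norm la' else 1.

Lemma hl_norm_neq0 la : hl_norm la != 0.
Proof. by elim: la => [|a la IHla]; rewrite ?oner_eq0 //= mulf_neq0. Qed.

Lemma strips_cons_same a la : head 0%N la = a -> (0 < a)%N ->
  strips (a :: la) = [seq a :: m | m <- strips la].
Proof.
move=> <- a_gt0 /=; rewrite /index_iota subSnn /=.
by elim: (strips la) => //= m s ->; rewrite cons_posE.
Qed.

Lemma strips_nseq_cat m a la : (0 < a)%N ->
  strips (nseq m a ++ a :: la) = [seq nseq m a ++ mu | mu <- strips (a :: la)].
Proof.
move=> a_gt0; elim: m => [|m IHm]; first by rewrite map_id.
rewrite [nseq _ _ ++ _]/= strips_cons_same //; last by case: (m).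
by rewrite IHm -map_comp.
Qed.

Lemma sumn_nseq_cat m a la : sumn (nseq m a ++ la) = (m * a + sumn la)%N.
Proof. by rewrite sumn_cat sumn_nseq mulnC. Qed.

Lemma psi_nseq_cat m a la mu : ispart (nseq m a ++ a :: la) -> mu \in strips (a :: la) ->
  psi_skew (nseq m a ++ a :: la) (nseq m a ++ mu) = psi_skew (a :: la) mu.
Proof.
elim: m => [|m IHm] // p imu.
have := p; rewrite ispart_cons => /and3P[a_gt0 le_a p'].
rewrite -(IHm p' imu) /= -(cons_posE (nseq m a ++ mu) a_gt0) psi_skew_cons //.
- by rewrite ltnn andbF /= mulr1.
- by rewrite strips_nseq_cat // map_f.
- by rewrite leqnn andbT.
Qed.

Lemma hl_norm_nseq_cat m a mu : ispart mu -> (head 0 mu < a)%N ->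
  hl_norm (nseq m a ++ mu) = (\prod_(i < m) qint t i.+1) * hl_norm mu.
Proof.
move=> pmu lt_a; elim: m => [|m IHm]; first by rewrite big_ord0 mul1r.
rewrite /= IHm big_ord_recr /= mulrA; congr (_ * _); rewrite mulrC; congr (_ * qint t _.+1).
by rewrite count_cat count_nseq /= eqxx mul1n ispart_count_gt ?addn0.
Qed.

Lemma ispart_split la : ispart la -> ~~ nilp la -> exists m l',
  [/\ la = nseq m (head 0 la) ++ head 0%N la :: l', ispart l' &
      (head 0 l' < head 0 la)%N].
Proof.
elim: la => // a la IHla; rewrite ispart_cons => /and3P[a_gt0 le_a pla] _.
have [la0|la_n0] := boolP (nilp la).
  by exists 0%N, [::]; rewrite (nilP la0).
move: le_a; rewrite leq_eqVlt => /predU1P[ea|lt_a]; last by exists 0%N, la.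
have [m [l' [e pl' lt_h]]] := IHla pla la_n0.
exists m.+1, l'; rewrite ea in e lt_h.
by split; rewrite //= -e.
Qed.

(** The branching coefficient for the unnormalized R_la; the quotient of norms disappears on passing
    to P_la. *)
Definition hl_term z la mu : F :=
  hl_norm la / hl_norm mu * phi (psi_skew la mu) * z ^+ (sumn la - sumn mu).

Lemma phi_1subX k : phi (1 - 'X ^+ k) = 1 - t ^+ k.
Proof. by rewrite rmorphB rmorph1 rmorphXn. Qed.

(** Write la as m + 1 rows of length a above l', whose largest part b is less than a. A strip of la
    amounts to a strip mu of l' and a new length c for the lowest row of length a. The case c = a
    comes from the term without defect, c = b from the first part of the lowered defect, and b < c <
    a from its sum over T_c. *)
Lemma hl_R_branch la z xs : ispart la -> uniq (z :: xs) ->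
  hl_R t la (z :: xs) = \sum_(mu <- strips la) hl_term z la mu * hl_R t mu xs.
Proof.
have [k] := ubnP (head 0%N la); elim: k la z xs => // k IHk la z xs.
rewrite ltnS => le_k pla Uzxs.
have [/nilP->|la_n0] := boolP (nilp la).
  by rewrite big_seq1 /hl_term /= psi_skew_nil rmorph1 divr1 !mulr1.
have [m [l']] := ispart_split pla la_n0; set a := head 0%N la in le_k *.
set b := head 0%N l' => -[ela pl' lt_b].
have a_gt0 : (0 < a)%N by apply: leq_ltn_trans lt_b.
have pal' : ispart (a :: l') by rewrite ispart_cons a_gt0 (ltnW lt_b).
have lt_bk : (b < k)%N by apply: leq_trans le_k.
pose K ys := hl_R t l' (z :: ys).
have EK ys : uniq (z :: ys) ->
    K ys = \sum_(mu <- strips l') hl_term z l' mu * hl_R t mu ys.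
  by move=> Uys; rewrite /K IHk.
(* The coefficient of R_(c, mu) in the lowered defect, up to the power z^(a-c). *)
pose e mu c := hl_norm l' / hl_norm (cons_pos c mu) *
  phi (psi_skew (a :: l') (cons_pos c mu)) * z ^+ (sumn l' - sumn mu).
have E1 ys : uniq (z :: ys) ->
    hl_op t b (hl_R t l') (z :: ys) - t * hl_op t b K ys =
    \sum_(mu <- strips l') e mu b * hl_R t (cons_pos b mu) ys.
  (* For b = 0 the rest l' is empty, and the claim is [k+1] - t [k] = 1 with k variables. *)
  move=> Uys; have [b0|b_gt0] := posnP b.
    have /nilP l0 : nilp l' by rewrite -ispart_head0 //; apply/eqP.
    have /andP[_ Uy] := Uys.
    rewrite /e b0 /K l0 big_seq1 !hl_op0_1 //= qintS -addrA subrr addr0.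
    rewrite -[[::]]/(cons_pos 0 [::]) psi_skew_cons ?inE //=; last first.
      by rewrite ispart_cons a_gt0.
    by rewrite psi_skew_nil !mulr1 rmorph1 divr1 !mulr1.
  have pbl' : ispart (b :: l') by rewrite ispart_cons b_gt0 leqnn.
  have -> : hl_op t b K ys =
      \sum_(mu <- strips l') hl_term z l' mu * hl_R t (b :: mu) ys.
    rewrite (@eq_hl_op _ _ _ _
      (fun ys => \sum_(mu <- strips l') hl_term z l' mu * hl_R t mu ys)).
      by rewrite hl_op_sum; apply: eq_bigr => mu _; rewrite hl_opZ.
    by move=> x _; apply: EK; apply: uniq_cons_rem.
  (* Since b < a, the induction hypothesis covers [b :: l'] as well as l'. *)
  rewrite -/(hl_R t (b :: l')) IHk // strips_cons_same // big_map mulr_sumr -sumrB.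
  apply: eq_big_seq => mu imu; rewrite mulrA -mulrBl cons_posE //; congr (_ * _).
  have -> : hl_term z (b :: l') (b :: mu) =
      hl_norm (b :: l') / hl_norm (b :: mu) * phi (psi_skew l' mu) *
      z ^+ (sumn l' - sumn mu).
    rewrite /hl_term -[in psi_skew _ _](cons_posE mu b_gt0) psi_skew_cons ?leqnn //.
    by rewrite ltnn andbF mulr1 /= subnDl.
  rewrite /hl_term /e cons_posE // -[in psi_skew (a :: _) _](cons_posE mu b_gt0).
  rewrite psi_skew_cons ?leqnn ?(ltnW lt_b) // rmorphM.
  have cb : count_mem b l' = (skew_col l' mu b + count_mem b mu)%N.
    exact: strips_count_head.
  rewrite b_gt0 lt_b [hl_norm (b :: l')]/= [hl_norm (b :: mu)]/= cb.
  have q1 := qint_neq0 (count_mem b mu); have n1 := hl_norm_neq0 mu.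
  (* Let k be the multiplicity of b in mu. If column b has a box, then [k+2]/[k+1] - t = 1/[k+1].
     Otherwise 1 - t = (1 - t^(k+1))/[k+1], whose numerator is the new factor of psi. *)
  case: (skew_col l' mu b); rewrite /= ?rmorph1 ?phi_1subX ?add0n ?add1n.
    rewrite qintS mulr1; move: (z ^+ _) (phi _) (hl_norm l') => Z P u.
    by field; rewrite n1.
  rewrite -mul_qint; move: (z ^+ _) (phi _) (hl_norm l') => Z P u.
  by field; rewrite n1.
have lt_h mu : mu \in strips l' -> (head 0 mu < a)%N.
  by move=> imu; apply: leq_ltn_trans (strips_head pl' imu) _.
have pmu mu : mu \in strips l' -> ispart mu by apply: strips_ispart.
have pcons c mu : mu \in strips l' -> (b <= c < a)%N -> ispart (cons_pos c mu).
  move=> imu /andP[ge_c lt_c]; case: c ge_c {lt_c} => [|c] ge_c; first exact: pmu.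
  by rewrite ispart_cons pmu // (leq_trans (strips_head pl' imu)).
have norm_la : hl_norm la = (\prod_(i < m) qint t i.+1) * qint t m.+1 * hl_norm l'.
  rewrite ela -[a :: l']/(nseq 1 a ++ l') catA -nseqD addn1 hl_norm_nseq_cat //.
  by rewrite big_ord_recr.
have n0 : \prod_(i < m) qint t i.+1 != 0 by apply/prodf_neq0.
have term_la c mu : mu \in strips l' -> (b <= c <= a)%N ->
    hl_term z la (nseq m a ++ cons_pos c mu) =
    hl_norm la / hl_norm (nseq m a ++ cons_pos c mu) *
    phi (psi_skew (a :: l') (cons_pos c mu)) *
    (z ^+ (a - c) * z ^+ (sumn l' - sumn mu)).
  move=> imu /andP[ge_c le_c]; rewrite /hl_term.
  have -> : psi_skew la (nseq m a ++ cons_pos c mu) =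
      psi_skew (a :: l') (cons_pos c mu).
    rewrite ela psi_nseq_cat -?ela //.
    by apply/allpairsPdep; exists mu, c; rewrite mem_index_iota ge_c ltnS le_c.
  rewrite ela !sumn_nseq_cat subnDl /= sumn_cons_pos -exprD; congr (_ * z ^+ _).
  have := strips_sumn pl' imu; move: le_c; clear; lia.
have term_top mu : mu \in strips l' ->
    hl_term z la (nseq m a ++ a :: mu) = hl_term z l' mu.
  move=> imu; rewrite -(cons_posE mu a_gt0) term_la //; last by rewrite leqnn (ltnW lt_b).
  rewrite psi_skew_cons // ?leqnn ?(ltnW lt_b) // ltnn andbF mulr1 subnn mul1r.
  congr (_ * _ * _); rewrite norm_la cons_posE // -[a :: mu]/(nseq 1 a ++ mu).
  rewrite catA -nseqD addn1 hl_norm_nseq_cat ?pmu ?lt_h // big_ord_recr /=.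
  by field; rewrite hl_norm_neq0 qint_neq0 n0.
have term_low c mu : mu \in strips l' -> (b <= c < a)%N ->
    hl_term z la (nseq m a ++ cons_pos c mu) =
    qint t m.+1 * (z ^+ (a - c) * e mu c).
  move=> imu /andP[ge_c lt_c]; rewrite term_la ?ge_c ?(ltnW lt_c) //.
  rewrite hl_norm_nseq_cat ?pcons ?ge_c //; last first.
    by case: c ge_c lt_c => [|c] _ // _; apply: lt_h.
  rewrite norm_la /e; field; rewrite n0 andbT; exact: hl_norm_neq0.
(* Here column c of l' / mu is empty and mu has no part c, so the new factor of psi is 1 - t. *)
have e_mid c mu : mu \in strips l' -> (b < c < a)%N ->
    e mu c = (1 - t) * hl_term z l' mu.
  move=> imu /andP[gt_c lt_c]; have c_gt0 : (0 < c)%N by apply: leq_trans gt_c.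
  rewrite /e psi_skew_cons ?(ltnW gt_c) ?(ltnW lt_c) // c_gt0 lt_c.
  rewrite skew_col_gt_head // cons_posE // rmorphM.
  rewrite ispart_count_gt ?pmu ?(leq_ltn_trans (strips_head pl' imu)) //=.
  rewrite ispart_count_gt ?pmu ?(leq_ltn_trans (strips_head pl' imu)) //=.
  rewrite phi_1subX expr1 /hl_term /qint big_ord1 mul1r.
  by ring.
rewrite [X in hl_R t X (z :: xs)]ela hl_R_cat_nseq -[hl_R t (a :: l')]/(iter 1 (hl_op t a) (hl_R t l')).
rewrite -iterD addn1 iter_hl_op_cons //.
have -> : strips la = [seq nseq m a ++ mu | mu <- strips (a :: l')].
  by rewrite ela strips_nseq_cat.
rewrite big_map [strips _]/= big_allpairs_dep.
rewrite (@eq_iter_hl_op _ t z a m.+1 _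
   (fun ys => \sum_(mu <- strips l') hl_term z l' mu * hl_R t mu ys)) //.
rewrite [m.+1.-1]/= (@eq_iter_hl_op _ t z a m _
   (fun ys => \sum_(mu <- strips l') (z ^+ (a - b) * (e mu b * hl_R t (cons_pos b mu) ys) +
     \sum_(b.+1 <= c < a) z ^+ (a - c) * (e mu c * hl_R t (cons_pos c mu) ys)))) //; last first.
  move=> ys Uys; rewrite (hl_defect_lower _ _ Uys lt_b) E1 // big_split mulr_sumr.
  congr (_ + _); rewrite exchange_big mulr_sumr [LHS]big_nat_cond [RHS]big_nat_cond.
  apply: eq_bigr => c /andP[/andP[gt_c lt_c] _].
  rewrite (@eq_hl_op _ t c _ (fun ys => \sum_(mu <- strips l') hl_term z l' mu * hl_R t mu ys)).
    rewrite hl_op_sum !mulr_sumr; apply: eq_big_seq => mu imu.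
    rewrite e_mid ?gt_c // cons_posE ?(leq_trans _ gt_c) // hl_opZ.
    by rewrite -!mulrA mulrCA.
  by move=> x _; apply: EK; apply: uniq_cons_rem.
rewrite !iter_hl_op_sum mulr_sumr -big_split; apply: eq_big_seq => mu imu /=.
(* The extreme lengths c = a and c = b are split off; the others match the sum over T_c. *)
rewrite big_nat_recr /= 1?ltnW // big_ltn // [RHS]addrC -(iterS m (hl_op t a)) iter_hl_opZ iterSr (cons_posE mu a_gt0).
rewrite -[hl_op t a (hl_R t mu)]/(hl_R t (a :: mu)) term_top // hl_R_cat_nseq.
congr (_ + _); rewrite iter_hl_opD iter_hl_opZ iter_hl_op_sum mulrDr.
rewrite term_low ?leqnn // hl_R_cat_nseq iter_hl_opZ !mulrA; congr (_ + _).
rewrite mulr_sumr [LHS]big_nat_cond [RHS]big_nat_cond.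
apply: eq_bigr => c /andP[/andP[gt_c lt_c] _].
by rewrite term_low ?lt_c ?(ltnW gt_c) // !iter_hl_opZ hl_R_cat_nseq !mulrA.
Qed.

End Branching.

(** * Tableaux *)

Lemma nth_shape (T : seq (seq nat)) i : nth 0%N (shape T) i = size (nth [::] T i).
Proof.
have [lt_i|le_i] := ltnP i (size T); first by rewrite (nth_map [::]).
by rewrite !nth_default // size_map.
Qed.

Lemma is_ssytP nu T :
  reflect [/\ shape T = nu, {in T, forall r, sorted leq r} &
    forall i j, (j < nth 0 nu i.+1)%N ->
      (nth 0 (nth [::] T i) j < nth 0 (nth [::] T i.+1) j)%N]
  (is_ssyt nu T).
Proof.
apply: (iffP and3P) => [[/eqP <- /allP sT H]|[<- sT H]].
  split=> // i j; rewrite nth_shape => lt_j.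
  have lt_i : (i < size T)%N.
    by rewrite ltnNge; apply: contraL lt_j => le_i; rewrite nth_default // ltnW.
  by apply: (allP (allP H i _) j); rewrite mem_iota.
split; [by []|exact/allP|].
apply/allP => i _; apply/allP => j; rewrite mem_iota => /andP[_ lt_j].
by apply: H; rewrite nth_shape.
Qed.

Definition ext_tab N (la : seq nat) (T : seq (seq nat)) :=
  [seq nth [::] T i ++ nseq (nth 0%N la i - size (nth [::] T i)) N
     | i <- iota 0 (size la)].

(** Peeling off the largest letter mirrors the branching rule, so that the tableau formula becomes
    an induction on the number of variables. *)
Fixpoint tabs N (la : seq nat) : seq (seq (seq nat)) :=
  if N is N'.+1 then
    [seq ext_tab N' la T | mu <- strips la, T <- tabs N' mu]
  else if la is [::] then [:: [::]] else [::].

Definition restr_tab N (T : seq (seq nat)) :=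
  [seq r <- [seq [seq c <- row | (c < N)%N] | row <- T] | ~~ nilp r].

(** Row lengths decrease, so empty rows occur only at the end and deleting them shifts no other
    row. *)
Lemma nth_filter_nilp (T : eqType) (R : seq (seq T)) i :
  (forall i, (size (nth [::] R i.+1) <= size (nth [::] R i))%N) ->
  nth [::] [seq r <- R | ~~ nilp r] i = nth [::] R i.
Proof.
elim: R i => //= r R IHR i H.
have [/nilP r0|] := boolP (nilp r) => /=; last first.
  by case: i => [|i] //= _; apply: IHR => j; apply: (H j.+1).
have all0 j : nth [::] (r :: R) j = [::].
  elim: j => //= j /(congr1 size) sz; apply/nilP; rewrite /nilp -leqn0.
  by have := H j; rewrite /= sz.
rewrite all0; have -> : [seq r0 <- R | ~~ nilp r0] = [::].
  apply/eqP; rewrite -[_ == _]negbK -has_filter; apply/hasPn => s /(nthP [::])[j _ <-].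
  by have /= -> := all0 j.+1.
by rewrite nth_nil.
Qed.

Lemma sorted_filter_ltn N r : sorted leq r -> all (fun c => (c < N.+1)%N) r ->
  r = [seq c <- r | (c < N)%N] ++ nseq (size r - size [seq c <- r | (c < N)%N]) N.
Proof.
elim: r => //= a r IHr sr /andP[le_a le_r].
have [lt_a|ge_a] := ltnP a N; first by rewrite /= subSS -IHr // (path_sorted sr).
have ea : a = N by apply/eqP; rewrite eqn_leq ge_a -ltnS le_a.
have allN : all (pred1 N) r.
  apply/allP => c cr /=; rewrite eqn_leq -ltnS (allP le_r) //=.
  by rewrite -ea; apply: (allP (order_path_min leq_trans sr)).
have -> : [seq c <- r | (c < N)%N] = [::].
  by rewrite (eq_in_filter (a2 := pred0)) ?filter_pred0 // => c /(allP allN)/eqP->; rewrite ltnn.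
by rewrite subn0 /= ea; congr cons; apply/all_pred1P.
Qed.

Lemma ispart_nth la : (forall i, (nth 0 la i.+1 <= nth 0 la i)%N) -> 0%N \notin la ->
  ispart la.
Proof. by move=> H n0; rewrite /ispart n0 andbT; apply/(sortedP 0%N) => i _; apply: H. Qed.

Lemma nth_ext_tab N la mu T i : is_strip la mu -> shape T = mu ->
  nth [::] (ext_tab N la T) i =
  nth [::] T i ++ nseq (nth 0 la i - nth 0 mu i) N.
Proof.
case/is_stripP => pmu le_s _ sT; rewrite -sT nth_shape.
have [lt_i|le_i] := ltnP i (size la).
  by rewrite (nth_map 0%N) ?size_iota // nth_iota.
have sz : size T = size mu by rewrite -sT size_map.
by rewrite !nth_default ?size_map ?size_iota // sz (leq_trans le_s).
Qed.

Lemma shape_ext_tab N la mu T : is_strip la mu -> shape T = mu ->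
  shape (ext_tab N la T) = la.
Proof.
move=> smu sT; have /is_stripP[_ _ H] := smu.
apply: (@eq_from_nth _ 0%N); first by rewrite !size_map size_iota.
move=> i _; rewrite nth_shape (nth_ext_tab _ _ smu sT) size_cat size_nseq.
by rewrite -nth_shape sT subnKC //; have /andP[] := H i.
Qed.

Lemma ssyt_entry_lt N nu T i j : all (all (fun c => (c < N)%N)) T -> shape T = nu ->
  (j < nth 0 nu i)%N -> (nth 0 (nth [::] T i) j < N)%N.
Proof.
move=> entT <-; rewrite nth_shape => lt_j.
have lt_i : (i < size T)%N.
  by rewrite ltnNge; apply: contraL lt_j => le_i; rewrite nth_default.
exact: (allP (allP entT _ (mem_nth _ lt_i)) _ (mem_nth _ lt_j)).
Qed.

Lemma sorted_cat_nseq N (r : seq nat) k : sorted leq r -> all (fun c => (c < N)%N) r ->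
  sorted leq (r ++ nseq k N).
Proof.
move=> sr rN; rewrite (sorted_pairwise leq_trans) pairwise_cat -!(sorted_pairwise leq_trans) sr /=.
apply/andP; split; last first.
  by elim: k => //= -[|k] //= ->; rewrite leqnn.
apply/allrelP => x y /(allP rN) lt_x; rewrite mem_nseq => /andP[_ /eqP->]; exact: ltnW.
Qed.

Lemma ext_tab_ssyt N la mu T : is_strip la mu -> is_ssyt mu T ->
  all (all (fun c => (c < N)%N)) T ->
  is_ssyt la (ext_tab N la T) && all (all (fun c => (c < N.+1)%N)) (ext_tab N la T).
Proof.
move=> smu /is_ssytP[sT rT cT] entT; have /is_stripP[pmu le_s H] := smu.
have rows r : r \in ext_tab N la T -> exists2 r', (r' \in T) || nilp r' & exists k, r = r' ++ nseq k N.
  case/mapP => i _ ->; exists (nth [::] T i); last by eexists.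
  have [lt_i|le_i] := ltnP i (size T); first by rewrite mem_nth.
  by rewrite nth_default // orbT.
apply/andP; split.
  apply/is_ssytP; split; first exact: shape_ext_tab smu sT.
    move=> r /rows[r' r'T [k ->]]; apply: sorted_cat_nseq.
      by case/orP: r'T => [/rT|/nilP->].
    by case/orP: r'T => [/(allP entT)|/nilP->].
  move=> i j lt_j; rewrite !(nth_ext_tab _ _ smu sT) !nth_cat -!nth_shape sT.
  have lt_ij : (j < nth 0 mu i)%N by apply: leq_trans lt_j _; have /andP[] := H i.
  rewrite lt_ij; case: (ltnP j (nth 0%N mu i.+1)) => [/cT //|le_j].
  rewrite nth_nseq ltn_sub2r ?(leq_ltn_trans le_j) //.
  exact: ssyt_entry_lt sT lt_ij.
apply/allP => r /rows[r' r'T [k ->]]; rewrite all_cat; apply/andP; split.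
  case/orP: r'T => [/(allP entT)|/nilP-> //]; apply: sub_all => c; exact: ltnW.
by apply/allP => c; rewrite mem_nseq => /andP[_ /eqP->] /=.
Qed.

Section Restriction.
Variables (N : nat) (la : seq nat) (T : seq (seq nat)).
Hypotheses (pla : ispart la) (ssT : is_ssyt la T).
Hypothesis entT : all (all (fun c => (c < N.+1)%N)) T.
Let R := [seq [seq c <- row | (c < N)%N] | row <- T].

Let sT : shape T = la. Proof. by have /is_ssytP[] := ssT. Qed.

Let nthR i : nth [::] R i = [seq c <- nth [::] T i | (c < N)%N].
Proof.
have [lt_i|le_i] := ltnP i (size T); first by rewrite (nth_map [::]).
by rewrite !nth_default ?size_map.
Qed.

Let rowE i : nth [::] T i = nth [::] R i ++ nseq (nth 0 la i - size (nth [::] R i)) N.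
Proof.
rewrite nthR -sT nth_shape; have [lt_i|le_i] := ltnP i (size T).
  apply: sorted_filter_ltn; last by apply: (allP entT); apply: mem_nth.
  by have /is_ssytP[_ H _] := ssT; apply/H/mem_nth.
by rewrite !nth_default.
Qed.

(** If a removed box of row i had a box below it, that box would have to exceed N, against [entT].
    Hence deleting the letter N removes a horizontal strip. *)
Let size_R i : (nth 0 la i.+1 <= size (nth [::] R i) <= nth 0 la i)%N.
Proof.
apply/andP; split; last first.
  by rewrite nthR -sT nth_shape size_filter count_size.
rewrite leqNgt; apply/negP => lt_s.
have /is_ssytP[_ _ /(_ i _ lt_s)] := ssT.
have lt_s' : (size (nth [::] R i) < nth 0 la i)%N.
  by apply: leq_trans lt_s (ispart_nth_le _ pla).
rewrite (rowE i) nth_cat ltnn subnn nth_nseq subn_gt0 lt_s'.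
rewrite ltnNge => /negP; apply; rewrite -ltnS.
exact: ssyt_entry_lt entT sT lt_s.
Qed.

Let nth_restr i : nth [::] (restr_tab N T) i = nth [::] R i.
Proof.
apply: nth_filter_nilp => j; have /andP[le_j _] := size_R j.
by apply: leq_trans le_j; have /andP[] := size_R j.+1.
Qed.

Lemma restr_strip : is_strip la (shape (restr_tab N T)).
Proof.
have H i : (nth 0 la i.+1 <= nth 0 (shape (restr_tab N T)) i <= nth 0 la i)%N.
  by rewrite nth_shape nth_restr.
apply/is_stripP; split=> //.
  apply: ispart_nth => [i|].
    have /andP[_] := H i.+1; move/leq_trans; apply; by have /andP[] := H i.
  by apply/negP => /mapP[r]; rewrite mem_filter => /andP[+ _] => /[swap]/esym/eqP/[swap]/negP.
by rewrite size_map -sT size_map size_filter (leq_trans (count_size _ _)) // size_map.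
Qed.

Lemma restr_ssyt : is_ssyt (shape (restr_tab N T)) (restr_tab N T) &&
  all (all (fun c => (c < N)%N)) (restr_tab N T).
Proof.
apply/andP; split; last first.
  apply/allP => r; rewrite mem_filter => /andP[_ /mapP[s _ ->]].
  exact: filter_all.
have /is_ssytP[_ rT cT] := ssT.
apply/is_ssytP; split=> // [r|i j].
  rewrite mem_filter => /andP[_ /mapP[s sTs ->]].
  by apply: (sorted_filter leq_trans); apply: rT.
rewrite nth_shape !nth_restr => lt_j.
have lt_ji : (j < size (nth [::] R i))%N.
  apply: leq_trans lt_j _; have /andP[_ le1] := size_R i.+1.
  by apply: leq_trans le1 _; have /andP[] := size_R i.
have lt_jl : (j < nth 0 la i.+1)%N.
  by apply: leq_trans lt_j _; have /andP[] := size_R i.+1.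
by have := cT _ _ lt_jl; rewrite (rowE i) (rowE i.+1) !nth_cat lt_ji lt_j.
Qed.

Lemma restr_tabK : ext_tab N la (restr_tab N T) = T.
Proof.
apply: (@eq_from_nth _ [::]).
  by rewrite size_map size_iota -sT size_map.
move=> i _; rewrite (nth_ext_tab _ _ restr_strip) // nth_shape nth_restr.
by rewrite -rowE.
Qed.

End Restriction.

Lemma ext_tabK N la mu T : is_strip la mu -> shape T = mu ->
  all (all (fun c => (c < N)%N)) T -> restr_tab N (ext_tab N la T) = T.
Proof.
move=> /is_stripP[pmu le_s H] sT entT; rewrite /restr_tab /ext_tab -map_comp.
have sz : size T = size mu by rewrite -sT size_map.
rewrite (@eq_map _ _ _ (nth [::] T)) => [|i] /=; last first.
  rewrite filter_cat (_ : filter _ (nseq _ _) = [::]); last first.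
    by elim: (_ - _)%N => //= k ->; rewrite ltnn.
  rewrite cats0; apply/all_filterP; have [lt_i|le_i] := ltnP i (size T).
    by apply: (allP entT); apply: mem_nth.
  by rewrite nth_default.
rewrite -(subnKC le_s) -sz iotaD map_cat filter_cat map_nth_iota0 // take_size.
have /all_filterP-> : all (fun r => ~~ nilp r) T.
  apply/allP => r rT; apply/negP => /nilP r0.
  have /andP[_ /negP] := pmu; apply; rewrite -sT; apply/mapP.
  by exists r; rewrite // r0.
rewrite -[RHS]cats0; congr (_ ++ _); rewrite filter_map.
rewrite (@eq_in_filter _ _ pred0) ?filter_pred0 // => i.
by rewrite mem_iota /= => /andP[le_i _]; rewrite nth_default.
Qed.

Lemma mem_tabs N la T : ispart la ->
  (T \in tabs N la) = is_ssyt la T && all (all (fun c => (c < N)%N)) T.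
Proof.
elim: N la T => [|N IHN] la T pla /=.
  apply/idP/andP => [|[/is_ssytP[sT _ _] entT]].
    by case: la pla => // _; rewrite inE => /eqP->.
  suff T0 : T = [::] by rewrite -sT T0.
  case: T sT entT => // -[|c r] T //= sT.
  by move: pla; rewrite -sT ispart_cons.
apply/allpairsPdep/andP => [[mu [T' [imu]]]|[ssT entT]].
  have pmu := strips_ispart pla imu.
  rewrite IHN // => /andP[ssT' entT'] ->; apply/andP.
  by apply: ext_tab_ssyt ssT' entT'; rewrite -mem_strips.
exists (shape (restr_tab N T)), (restr_tab N T).
have smu := restr_strip pla ssT entT.
rewrite mem_strips // smu IHN ?restr_tabK //; first by split=> //; apply: restr_ssyt pla ssT entT.
by have /is_stripP[] := smu.
Qed.

Lemma tabs_shape N la T : ispart la -> T \in tabs N la -> shape T = la.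
Proof. by move=> pla; rewrite mem_tabs // => /andP[/is_ssytP[]]. Qed.

Lemma uniq_tabs N la : ispart la -> uniq (tabs N la).
Proof.
elim: N la => [|N IHN] la pla; first by case: la pla.
apply: allpairs_uniq_dep => [|mu imu|p q]; first exact: uniq_strips.
  by apply: IHN; apply: strips_ispart imu.
have st_mem (p0 : {_ : seq nat & seq (seq nat)}) :
    p0 \in [seq existT (fun=> seq (seq nat)) mu T0 | mu <- strips la, T0 <- tabs N mu] ->
    [/\ is_strip la (tag p0), shape (tagged p0) = tag p0 &
        all (all (fun c => (c < N)%N)) (tagged p0)].
  case/allpairsPdep => mu [T0 [imu + ->]] /=; have pmu := strips_ispart pla imu.
  by rewrite mem_tabs // => /andP[/is_ssytP[]]; rewrite -mem_strips.
case: p => mu T; case: q => mu' T' /st_mem /= [s1 s2 s3] /st_mem /= [s1' s2' s3'] eqT.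
have eT : T = T' by rewrite -(ext_tabK s1 s2 s3) eqT (ext_tabK s1' s2' s3').
by move: s2 s2'; rewrite eT => <- <-.
Qed.

(** * Weights of tableaux along chains of shapes *)

Definition chain_psi (s : seq (seq nat)) : {poly int} :=
  \prod_(i < (size s).-1) psi_skew (nth [::] s i.+1) (nth [::] s i).

Lemma chain_psi_rcons la s : (0 < size s)%N ->
  chain_psi (rcons s la) = chain_psi s * psi_skew la (last [::] s).
Proof.
move=> s_gt0; rewrite /chain_psi size_rcons; case: s s_gt0 => // m s _ /=.
rewrite big_ord_recr /= -rcons_cons; congr (_ * psi_skew _ _).
- apply: eq_bigr => i _; have := ltn_ord i; move=> lt_i.
  by rewrite !nth_rcons /= lt_i ltnS (ltnW lt_i).
- by rewrite nth_rcons ltnn eqxx.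
- by rewrite nth_rcons ltnSn -[last m s]/(last [::] (m :: s)) -nth_last.
Qed.

Lemma psi_skew_refl la : psi_skew la la = 1.
Proof.
rewrite /psi_skew big_nat_cond big_pred0 // => j.
have skew0 k : skew_col la la k = false.
  by apply/skew_colP => -[i _ /andP[/leq_trans H /H]]; rewrite ltnn.
by rewrite !skew0 /= andbF.
Qed.

Lemma subshape_max a T : 0%N \notin shape T -> all (all (fun c => (c <= a)%N)) T ->
  subshape T a = shape T.
Proof.
move=> n0 entT; rewrite /subshape.
have -> : [seq count (fun c => (c <= a)%N) row | row <- T] = shape T.
  by apply/eq_in_map => r /(allP entT); rewrite all_count => /eqP.
by apply/all_filterP/allP => k; apply: contraTT; rewrite -eqn0Ngt => /eqP->.
Qed.

Lemma count_le_cat_nseq a N (r : seq nat) k : (a < N)%N ->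
  count (fun c => (c <= a)%N) (r ++ nseq k N) = count (fun c => (c <= a)%N) r.
Proof. by move=> lt_a; rewrite count_cat count_nseq leqNgt lt_a mul0n addn0. Qed.

Lemma subshape_ext_tab a N la mu T : is_strip la mu -> shape T = mu -> (a < N)%N ->
  subshape (ext_tab N la T) a = subshape T a.
Proof.
move=> /is_stripP[pmu le_s H] sT lt_a; rewrite /subshape /ext_tab -map_comp.
have sz : size T = size mu by rewrite -sT size_map.
rewrite (@eq_map _ _ _ (fun i => count (fun c => (c <= a)%N) (nth [::] T i))); last first.
  by move=> i /=; rewrite count_le_cat_nseq.
rewrite -(subnKC le_s) -sz iotaD map_cat filter_cat.
have -> : [seq count (fun c => (c <= a)%N) (nth [::] T i) | i <- iota 0 (size T)] =
  [seq count (fun c => (c <= a)%N) r | r <- T].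
  by rewrite -[in RHS](mkseq_nth [::] T) -map_comp.
rewrite -[RHS]cats0; congr (_ ++ _).
rewrite filter_map (@eq_in_filter _ _ pred0) ?filter_pred0 // => i.
by rewrite mem_iota /= => /andP[le_i _]; rewrite nth_default.
Qed.

Lemma sorted_leq_last (s : seq nat) x : sorted leq s -> x \in s -> (x <= last 0 s)%N.
Proof.
move=> ss xs; rewrite -nth_last -[leqLHS](nth_index 0%N xs).
by apply: (sorted_leq_nth leq_trans leqnn) => //; rewrite ?inE ?index_mem //;
  have := xs; rewrite -index_mem; case: (s) => // ? ? _ /=.
Qed.

Lemma last_ssyt_chain T mu : shape T = mu -> ispart mu -> last [::] (ssyt_chain T) = mu.
Proof.
move=> sT /andP[_ n0]; rewrite /ssyt_chain /=.
set s := sort leq _; have memE c : (c \in s) = (c \in flatten T).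
  by rewrite mem_sort mem_undup.
have ss : sorted leq s by apply: sort_sorted; exact: leq_total.
have [s0|s_n0] := eqVneq s [::].
  have flat0 c : c \notin flatten T by rewrite -memE s0.
  rewrite s0 /=; move: sT n0 flat0; clear; case: T => [<- //|[|c r] T] /= <- //.
  by move=> _ /(_ c); rewrite inE eqxx.
rewrite (_ : last _ _ = subshape T (last 0%N s)); last first.
  by case: s {ss memE} s_n0 => //= a s _; rewrite last_map.
rewrite subshape_max ?sT //; apply/allP => r rT; apply/allP => c cr.
by apply: sorted_leq_last => //; rewrite memE; apply/flattenP; exists r.
Qed.

Lemma flatten_ext_tab N la mu T : is_strip la mu -> shape T = mu ->
  perm_eq (flatten (ext_tab N la T)) (flatten T ++ nseq (sumn la - sumn mu) N).
Proof.
move=> smu sT; have /is_stripP[pmu le_s H] := smu.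
have sz : size T = size mu by rewrite -sT size_map.
apply/seq.permP => p; rewrite count_cat count_nseq !count_flatten.
have sumE s k : (size s <= k)%N -> sumn s = \sum_(i < k) nth 0%N s i.
  move=> le_k; rewrite sumnE (big_nth 0%N) big_mkord.
  by rewrite (big_ord_widen _ _ le_k) big_mkcond; apply: eq_bigr => i _;
     case: ltnP => // le_i; rewrite nth_default.
have nth_count T' i : nth 0%N [seq count p r | r <- T'] i = count p (nth [::] T' i).
  have [lt_i|le_i] := ltnP i (size T'); first by rewrite (nth_map [::]).
  by rewrite !nth_default // size_map.
rewrite !(sumE _ (size la)) ?size_map ?size_iota ?sz //.
under eq_bigr => i _ do rewrite nth_count (nth_ext_tab _ _ smu sT) count_cat count_nseq.
rewrite big_split /= -big_distrr /=; congr (_ + _ * _)%N.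
  by apply: eq_bigr => i _; rewrite nth_count.
by rewrite sumnB // => i _; have /andP[] := H i.
Qed.

Lemma ispart_shape_pos la (T : seq (seq nat)) : ispart la -> shape T = la ->
  all (fun r => ~~ nilp r) T.
Proof.
move=> /andP[_ n0] sT; apply/allP => r rT; apply/negP => /nilP r0.
by move/negP: n0; apply; rewrite -sT; apply/mapP; exists r; rewrite // r0.
Qed.

Lemma restr_tab_id N (T : seq (seq nat)) : all (all (fun c => (c < N)%N)) T ->
  all (fun r => ~~ nilp r) T -> restr_tab N T = T.
Proof.
move=> entT posT; rewrite /restr_tab; have -> : [seq [seq c <- row | (c < N)%N] | row <- T] = T.
  by rewrite -[RHS]map_id; apply/eq_in_map => r /(allP entT)/all_filterP.
exact/all_filterP.
Qed.

(** If N occurs, the chain of the extended tableau has la as one further step. If not, la = mu and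
    the extra factor is [psi_skew la la], which is 1. *)
Lemma psi_ext_tab N la mu T : ispart la -> is_strip la mu -> is_ssyt mu T ->
  all (all (fun c => (c < N)%N)) T ->
  psi (ext_tab N la T) = psi T * psi_skew la mu.
Proof.
move=> pla smu ssT entT; have /is_ssytP[sT _ _] := ssT.
have /is_stripP[pmu le_s H] := smu; have fl := flatten_ext_tab N smu sT.
have n0 := ispart_shape_pos pla (shape_ext_tab N smu sT).
have [Nin|Nnin] := boolP (N \in flatten (ext_tab N la T)); last first.
  have entE : all (all (fun c => (c < N)%N)) (ext_tab N la T).
    apply/allP => r rE; apply/allP => c cr.
    have /andP[_ /allP/(_ _ rE)/allP/(_ _ cr)] := ext_tab_ssyt smu ssT entT.
    rewrite ltnS leq_eqVlt => /predU1P[ec|//]; case/negP: Nnin.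
    by apply/flattenP; exists r; rewrite // -ec.
  have ET : ext_tab N la T = T.
    rewrite -[RHS](ext_tabK smu sT entT) restr_tab_id //.
  by rewrite ET -(shape_ext_tab N smu sT) ET sT psi_skew_refl mulr1.
have sortE : sort leq (undup (flatten (ext_tab N la T))) =
             rcons (sort leq (undup (flatten T))) N.
  apply: (sorted_eq leq_trans anti_leq).
  - by apply: sort_sorted; exact: leq_total.
  - rewrite -cats1 (sorted_cat_nseq 1) //; first by apply: sort_sorted; exact: leq_total.
    apply/allP => c; rewrite mem_sort mem_undup => /flattenP[r rT cr].
    exact: (allP (allP entT _ rT)).
  rewrite perm_sort; apply: uniq_perm; rewrite ?undup_uniq //.
    rewrite rcons_uniq sort_uniq undup_uniq andbT mem_sort mem_undup.
    by apply/negP => /flattenP[r rT /(allP (allP entT _ rT))]; rewrite ltnn.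
  move=> c; rewrite mem_rcons inE mem_sort !mem_undup (perm_mem fl) mem_cat orbC mem_nseq.
  move: Nin; rewrite (perm_mem fl) mem_cat mem_nseq.
  have /negPf-> : N \notin flatten T.
    by apply/negP => /flattenP[r rT /(allP (allP entT _ rT))]; rewrite ltnn.
  by rewrite eqxx andbT => /= ->.
have -> : psi (ext_tab N la T) = chain_psi (rcons (ssyt_chain T) la).
  rewrite -[LHS]/(chain_psi (ssyt_chain _)); congr chain_psi.
  rewrite /ssyt_chain sortE map_rcons -rcons_cons; congr (rcons (_ :: _) _).
    apply/eq_in_map => a; rewrite mem_sort mem_undup => /flattenP[r rT ar].
    by apply: (subshape_ext_tab smu sT); apply: (allP (allP entT _ rT)).
  rewrite subshape_max ?(shape_ext_tab N smu sT) //.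
    by have /andP[] := pla.
  by have /andP[_] := ext_tab_ssyt smu ssT entT.
by rewrite chain_psi_rcons // (last_ssyt_chain sT pmu).
Qed.

(** * Tableau formula *)

Section TableauFormula.
Variables (F : fieldType) (phi : {rmorphism {poly int} -> F}).
Let t := phi 'X.
Hypothesis qint_neq0 : forall m, qint t m.+1 != 0.

Lemma hl_R_tableaux la xs : ispart la -> uniq xs ->
  hl_R t la xs = hl_norm phi la *
    \sum_(T <- tabs (size xs) la) phi (psi T) * \prod_(c <- flatten T) nth 0 xs c.
Proof.
(* The letter c stands for the entry c of the list, so the largest letter belongs to the last
   variable. The list therefore grows at its end, and z is brought to the front by symmetry of
   [hl_R]. *)
elim/last_ind: xs la => [|xs z IHxs] la pla Uxs.
  case: la pla => [|a la] pla /=; last by rewrite big_nil mulr0 /hl_op big_nil.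
  by rewrite big_seq1 /= big_nil /psi big_ord0 rmorph1 !mulr1.
have Uzxs : uniq (z :: xs) by rewrite cons_uniq -rcons_uniq.
have Uxs' : uniq xs by case/andP: Uzxs.
rewrite (hl_R_perm t la (ys := z :: xs)) ?perm_rcons // (hl_R_branch qint_neq0) //.
rewrite size_rcons [tabs _ _]/= big_allpairs_dep mulr_sumr.
apply: eq_big_seq => mu imu; have pmu := strips_ispart pla imu.
rewrite IHxs // /hl_term !mulr_sumr; apply: eq_big_seq => T.
rewrite mem_tabs // => /andP[ssT entT].
have smu : is_strip la mu by rewrite -mem_strips.
rewrite (psi_ext_tab pla smu ssT entT).
have /is_ssytP[sT _ _] := ssT.
rewrite (perm_big _ (flatten_ext_tab (size xs) smu sT)) big_cat /=.
rewrite [X in _ = _ * (_ * (_ * X))]big_nseq -Monoid.iteropE /= nth_rcons ltnn eqxx.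
rewrite (_ : iterop _ _ _ _ = z ^+ (sumn la - sumn mu)) //.
have -> : \prod_(c <- flatten T) nth 0 (rcons xs z) c = \prod_(c <- flatten T) nth 0 xs c.
  apply: eq_big_seq => c /flattenP[r rT cr].
  by rewrite nth_rcons (allP (allP entT _ rT)).
rewrite rmorphM; have := hl_norm_neq0 qint_neq0 mu.
move: (hl_norm _ _) (hl_norm _ _) (_ ^+ _) (phi _) (phi _) (\prod_(_ <- _) _) => a b c d e f b0.
by field.
Qed.

End TableauFormula.

(** * Specialization to N variables *)

Section Symmetrization.
Variables (F : fieldType) (t : F).

(** The summand of the symmetrization with the variables in the order s. Choosing the first variable
    of s is one application of [hl_op]. *)
Fixpoint hl_weight (la : seq nat) (s : seq F) : F :=
  if s is x :: s' then
    x ^+ head 0%N la * hl_kernel t x s' * hl_weight (behead la) s'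
  else 1.

Lemma sum_hl_weight la xs : uniq xs -> size la = size xs ->
  \sum_(s <- permutations xs) hl_weight la s = hl_R t la xs.
Proof.
elim: la xs => [|a la IHla] xs Uxs sz.
  by case: xs sz {Uxs} => //= _; rewrite /permutations /= big_seq1.
have xs_gt0 : (0 < size xs)%N by rewrite -sz.
rewrite (perm_big _ (permutationsE xs_gt0)) undup_id // big_allpairs_dep /=.
apply: eq_big_seq => x xxs /=; rewrite -IHla ?rem_uniq // ?size_rem -?sz //.
rewrite mulr_sumr; apply: eq_big_seq => s; rewrite mem_permutations => ps.
by rewrite (hl_kernel_perm t x ps).
Qed.

Lemma hl_weightE la (s : seq F) :
  hl_weight la s = (\prod_(i < size s) nth 0 s i ^+ nth 0%N la i) *
   \prod_(i < size s) \prod_(j < size s | (i < j)%N)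
      ((nth 0 s i - t * nth 0 s j) / (nth 0 s i - nth 0 s j)).
Proof.
elim: s la => [|x s IHs] la /=; first by rewrite !big_ord0 mulr1.
rewrite IHs !big_ord_recl /= nth0 -!mulrA; congr (_ * _).
rewrite mulrCA; congr (_ * _); first by apply: eq_bigr => i _; rewrite nth_behead.
congr (_ * _).
  rewrite [RHS]big_mkcond big_ord_recl /= mul1r /hl_kernel (big_nth 0) big_mkord.
  by apply: eq_bigr.
apply: eq_bigr => i _; rewrite [RHS]big_mkcond big_ord_recl /= mul1r big_mkcond.
by apply: eq_bigr.
Qed.

Lemma sum_perm_hl_weight N la (x : 'I_N -> F) : injective x ->
  \sum_(w : 'S_N) hl_weight la [seq x (w i) | i <- enum 'I_N] =
  \sum_(s <- permutations [seq x i | i <- enum 'I_N]) hl_weight la s.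
Proof.
move=> x_inj; rewrite -(big_map (fun w : 'S_N => [seq x (w i) | i <- enum 'I_N]) predT).
apply: perm_big; apply: uniq_perm; rewrite ?permutations_uniq //.
  rewrite map_inj_uniq ?index_enum_uniq // => w w' /eq_in_map eq_w.
  by apply/permP => i; apply: x_inj; apply: eq_w; rewrite mem_enum.
move=> s; rewrite mem_permutations; apply/mapP/idP => [[w _ ->]|].
  rewrite (map_comp x w); apply: perm_map.
  apply: uniq_perm; rewrite ?(map_inj_uniq perm_inj) ?enum_uniq // => i.
  rewrite mem_enum inE; apply/mapP; exists ((w^-1)%g i); rewrite ?mem_enum //.
  by rewrite permKV.
have sz : size [seq x i | i <- enum 'I_N] = N by rewrite size_map size_enum_ord.
rewrite -[X in perm_eq _ X]/(tval (Tuple (introT eqP sz))) => /tuple_permP[w ->].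
exists w; first by rewrite mem_index_enum.
apply: eq_map => i; rewrite (tnth_nth (x i)) /= (nth_map i) ?size_enum_ord //.
by rewrite nth_ord_enum.
Qed.

End Symmetrization.

Section Specialization.
Variable N : nat.

Definition hlc : {rmorphism {poly int} -> hlfrac N} :=
  GRing.RMorphism.clone _ _
    (@FracField.tofrac {mpoly {poly int}[N]} \o @mpolyC N {poly int}) _.

Lemma hlcE c : hlc c = c%:MP%:F. Proof. by []. Qed.

Lemma hlc_X : hlc 'X = hlt N. Proof. by []. Qed.

Lemma hlc_inj : injective hlc.
Proof.
move=> c d /eqP; rewrite !hlcE tofrac_eq => /eqP/(congr1 (mcoeff 0%MM)).
by rewrite !mcoeffC eqxx !mulr1.
Qed.

(** A q-integer has constant term 1, and Z[t] embeds in the fraction field. *)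
Lemma hlc_qint_neq0 m : qint (hlc 'X) m.+1 != 0.
Proof.
have -> : qint (hlc 'X) m.+1 = hlc (\sum_(i < m.+1) 'X ^+ i).
  by rewrite /qint rmorph_sum; apply: eq_bigr => i _; rewrite rmorphXn.
rewrite -(rmorph0 hlc) (inj_eq hlc_inj).
apply/eqP => /(congr1 (fun p : {poly int} => p.[0])).
rewrite horner0 horner_sum big_ord_recl big1 ?addr0 => [|i _].
  by rewrite hornerXn.
by rewrite hornerXn expr0n.
Qed.

Lemma hlt_neq1 : 1 - hlt N != 0.
Proof.
rewrite -hlc_X -(rmorph1 hlc) -rmorphB -(rmorph0 hlc) (inj_eq hlc_inj).
by rewrite subr_eq0 eq_sym; apply/eqP => /(congr1 (fun p : {poly int} => p.[0]));
  rewrite hornerX hornerE.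
Qed.

Lemma hl_vE m : hl_v N m = \prod_(i < m) qint (hlt N) i.+1.
Proof.
rewrite /hl_v big_add1 big_mkord; apply: eq_bigr => i _.
by rewrite -mul_qint mulrC mulKf ?hlt_neq1.
Qed.

Lemma card_nth_eq (la : seq nat) j : (size la <= N)%N ->
  #|[set i : 'I_N | nth 0%N la i == j]| =
  (count_mem j la + (if j == 0%N then N - size la else 0))%N.
Proof.
move=> le_N; rewrite cardsE cardE size_filter -(count_map val (fun i => nth 0%N la i == j)).
rewrite -enumT val_enum_ord -(count_map (nth 0%N la) (pred1 j)).
rewrite -(subnKC le_N) iotaD map_cat count_cat -[X in (count _ X + _)%N]/(mkseq _ _) mkseq_nth.
congr (_ + _)%N.
rewrite (_ : [seq nth 0%N la i | i <- _] = nseq (N - size la) 0%N); last first.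
  apply: (@eq_from_nth _ 0%N) => [|i]; first by rewrite size_map size_iota size_nseq.
  rewrite size_map size_iota => lt_i; rewrite (nth_map 0%N) ?size_iota // nth_iota //.
  by rewrite nth_nseq lt_i nth_default // leq_addr.
rewrite count_nseq /= eq_sym subnKC //.
by case: (j == 0%N); rewrite ?mul1n ?mul0n.
Qed.

(** A further row a turns v_k into v_(k+1) at j = a, which is multiplication by [k+1]; this is the
    recursion of [hl_norm]. *)
Lemma prod_hl_v (la : seq nat) M : 0%N \notin la -> all (fun i => (i <= M)%N) la ->
  \prod_(1 <= j < M.+1) hl_v N (count_mem j la) = hl_norm hlc la.
Proof.
elim: la => [|a la IHla] /=; first by rewrite big1 // => j _; rewrite hl_vE big_ord0.
rewrite inE negb_or eq_sym -lt0n => /andP[a_gt0 n0] /andP[le_a le_la].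
rewrite -IHla // mulrC.
rewrite (eq_bigr (fun j => hl_v N (count_mem j la) *
   (if j == a then qint (hlt N) (count_mem a la).+1 else 1))) => [|j _].
  rewrite big_split /=; congr (_ * _).
  by rewrite -big_mkcond big_nat1_eq a_gt0 ltnS le_a.
rewrite !hl_vE eq_sym; have [->|] := eqVneq a j; last by rewrite mulr1.
by rewrite add1n big_ord_recr.
Qed.

Lemma hl_vpartE (la : seq nat) : 0%N \notin la -> (size la <= N)%N ->
  hl_vpart N la = \prod_(i < N - size la) qint (hlt N) i.+1 * hl_norm hlc la.
Proof.
move=> n0 le_N; rewrite /hl_vpart big_ltn //; congr (_ * _).
  by rewrite card_nth_eq // eqxx hl_vE (count_memPn n0) add0n.
rewrite -(@prod_hl_v la (sumn la)) //; last by apply/allP => i /mem_leq_sumn.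
rewrite big_nat_cond [RHS]big_nat_cond; apply: eq_bigr => j /andP[/andP[j_gt0 _] _].
by rewrite card_nth_eq // (gtn_eqF j_gt0) addn0.
Qed.

Lemma hlx_inj : injective (@hlx N).
Proof.
move=> i j /eqP; rewrite /hlx tofrac_eq => /eqP/mpolyP/(_ U_(j)%MM)/eqP.
by rewrite !mcoeffXU eqxx; have [->|_] := eqVneq i j; rewrite // eq_sym oner_eq0.
Qed.

Definition hlxs := [seq @hlx N i | i <- enum 'I_N].

(** Padding la with zeros produces v_(m_0), which cancels the factor j = 0 of v_la. *)
Lemma HLE la : 0%N \notin la -> HL N la = (hl_norm hlc la)^-1 * hl_R (hlt N) la hlxs.
Proof.
move=> n0; have sz : size hlxs = N by rewrite size_map size_enum_ord.
have Uxs : uniq hlxs by rewrite (map_inj_uniq hlx_inj) enum_uniq.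
rewrite /HL; case: leqP => [le_N|lt_N]; last by rewrite hl_R_gt_size ?mulr0 ?sz.
rewrite hl_vpartE //.
have -> : \sum_(w : 'S_N) (\prod_(i < N) hlx (w i) ^+ nth 0%N la i) *
       \prod_(i < N) \prod_(j < N | (i < j)%N)
         ((hlx (w i) - hlt N * hlx (w j)) / (hlx (w i) - hlx (w j))) =
    \sum_(w : 'S_N) hl_weight (hlt N) (la ++ nseq (N - size la) 0%N)
       [seq hlx (w i) | i <- enum 'I_N].
  apply: eq_bigr => w _; rewrite hl_weightE size_map size_enum_ord.
  have nthE (i : 'I_N) : nth 0 [seq hlx (w i) | i <- enum 'I_N] i = hlx (w i).
    by rewrite (nth_map i) ?size_enum_ord // nth_ord_enum.
  congr (_ * _).
    apply: eq_bigr => i _; rewrite nthE nth_cat nth_nseq if_same.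
    by case: ltnP => // le_i; rewrite nth_default.
  by apply: eq_bigr => i _; apply: eq_bigr => j _; rewrite !nthE.
rewrite sum_perm_hl_weight; last exact: hlx_inj.
rewrite -/hlxs sum_hl_weight //; last by rewrite size_cat size_nseq subnKC // sz.
have := hl_R_pad0 (hlt N) (la := la) Uxs; rewrite sz => /(_ le_N) ->.
have : \prod_(i < N - size la) qint (hlt N) i.+1 != 0.
  by apply/prodf_neq0 => i _; rewrite -hlc_X hlc_qint_neq0.
move: (\prod_(_ < _) _) (hl_norm _ _) (hl_R _ _ _) => a b c a0.
by rewrite (mulrC a) invfM -mulrA (mulrC c) mulKf.
Qed.

End Specialization.

(** * Word series and their evaluation *)

Fixpoint words N n : seq (seq nat) :=
  if n is n'.+1 then [seq c :: s | c <- iota 0 N, s <- words N n'] else [:: [::]].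

Lemma mem_words N n s : (s \in words N n) = (size s == n) && all (fun c => (c < N)%N) s.
Proof.
elim: n s => [|n IHn] [|c s] //=; first by apply/allpairsP => -[[? ?] []].
rewrite eqSS; apply/allpairsP/and3P => [[[c' s'] [/= + + [-> ->]]]|[sz lt_c lt_s]].
  by rewrite mem_iota IHn => /andP[_ ->] /andP[-> ->].
by exists (c, s); rewrite mem_iota IHn sz.
Qed.

Lemma uniq_words N n : uniq (words N n).
Proof.
elim: n => //= n IHn; apply: allpairs_uniq => //; first exact: iota_uniq.
by move=> [c s] [c' s'] _ _ [-> ->].
Qed.

Definition mcontent N (s : seq nat) : 'X_{1..N} := [multinom count_mem (val i) s | i < N].

Lemma mcontentE N s i : mcontent N s i = count_mem (val i) s.
Proof. by rewrite mnmE. Qed.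

Lemma mcontent_cat N s1 s2 : mcontent N (s1 ++ s2) = (mcontent N s1 + mcontent N s2)%MM.
Proof. by apply/mnmP => i; rewrite mnmDE !mcontentE count_cat. Qed.

Lemma mcontent_perm N s1 s2 : perm_eq s1 s2 -> mcontent N s1 = mcontent N s2.
Proof. by move/seq.permP=> H; apply/mnmP => i; rewrite !mcontentE H. Qed.

Lemma mcontent_cons N (i : 'I_N) s : mcontent N (val i :: s) = (U_(i) + mcontent N s)%MM.
Proof. by apply/mnmP => j; rewrite mnmDE !mcontentE /= mnm1E -val_eqE. Qed.

Lemma mdeg_mcontent N s : all (fun c => (c < N)%N) s -> mdeg (mcontent N s) = size s.
Proof.
elim: s => [|c s IHs] /= => [_|/andP[lt_c lt_s]].
  by rewrite mdegE big1 // => i _; rewrite mcontentE.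
by rewrite (mcontent_cons (Ordinal lt_c)) mdegD mdeg1 IHs.
Qed.

Lemma sumn_mnm_pos N (m : 'X_{1..N}) : sumn [seq k <- m | (0 < k)%N] = mdeg m.
Proof.
rewrite mdegE sumnE big_filter big_tuple big_mkcond; apply: eq_bigr => i _.
by rewrite mnm_tnth; case: (tnth m i).
Qed.

Section Evaluation.
Variable R : comNzRingType.
Implicit Types (F G : ncseries R).

(** The commutative image of the degree n part, restricted to the first N variables. *)
Definition nceval N n F : {mpoly R[N]} :=
  \sum_(s <- words N n) F s *: 'X_[mcontent N s].

Definition nchomog n F := forall s, size s != n -> F s = 0.

Lemma mcoeff_nceval N n F m :
  (nceval N n F)@_m = \sum_(s <- words N n | mcontent N s == m) F s.
Proof.
rewrite /nceval raddf_sum [RHS]big_mkcond; apply: eq_bigr => s _ /=.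
by rewrite mcoeffZ mcoeffX; case: eqP => _; rewrite ?mulr1 ?mulr0.
Qed.

Lemma mcoeff_nceval_deg N n F m : mdeg m != n -> (nceval N n F)@_m = 0.
Proof.
move=> dm; rewrite mcoeff_nceval big_seq_cond big_pred0 // => s.
rewrite mem_words; apply/negP => /andP[/andP[/eqP sz lt_s] /eqP e].
by move: dm; rewrite -e mdeg_mcontent // sz eqxx.
Qed.

Lemma eq_nceval N n F G :
  (forall s, size s = n -> F s = G s) -> nceval N n F = nceval N n G.
Proof.
move=> H; apply: eq_big_seq => s; rewrite mem_words => /andP[/eqP sz _].
by rewrite H.
Qed.

Lemma words_cat N a b :
  perm_eq (words N (a + b)) [seq s1 ++ s2 | s1 <- words N a, s2 <- words N b].
Proof.
apply: uniq_perm; first exact: uniq_words.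
  apply: allpairs_uniq; try exact: uniq_words.
  move=> [s1 s2] [s1' s2'] /allpairsP[[u1 u2] [/= i1 i2 [-> ->]]].
  move=> /allpairsP[[v1 v2] [/= j1 j2 [-> ->]]] /eqP.
  rewrite !mem_words in i1 j1; case/andP: i1 => /eqP i1 _; case/andP: j1 => /eqP j1 _.
  by rewrite eqseq_cat ?i1 ?j1 // => /andP[/eqP-> /eqP->].
move=> s; rewrite mem_words; apply/andP/allpairsP => [[/eqP sz lt_s]|].
  exists (take a s, drop a s); rewrite !mem_words cat_take_drop /=.
  rewrite size_takel ?sz ?leq_addr // size_drop sz addKn !eqxx.
  by move: lt_s; rewrite -{1}(cat_take_drop a s) all_cat => /andP[-> ->].
case=> [[s1 s2] [/=]]; rewrite !mem_words => /andP[/eqP s1a l1] /andP[/eqP s2b l2] ->.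
by rewrite size_cat s1a s2b eqxx all_cat l1 l2.
Qed.

Lemma ncmul_homog a b F G s : nchomog a F -> size s = (a + b)%N ->
  ncmul F G s = F (take a s) * G (drop a s).
Proof.
move=> hF sz; rewrite /ncmul big_mkord.
have lt_a : (a < (size s).+1)%N by rewrite ltnS sz leq_addr.
rewrite (bigD1 (Ordinal lt_a)) //= big1 ?addr0 // => k ne_k.
rewrite hF ?mul0r // size_takel; first by rewrite -val_eqE in ne_k.
by rewrite -ltnS.
Qed.

Lemma nceval_mul N a b F G : nchomog a F ->
  nceval N (a + b) (ncmul F G) = nceval N a F * nceval N b G.
Proof.
move=> hF; rewrite /nceval (perm_big _ (words_cat N a b)) big_allpairs_dep mulr_suml.
apply: eq_big_seq => s1; rewrite mem_words => /andP[/eqP sz1 _].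
rewrite mulr_sumr; apply: eq_big_seq => s2; rewrite mem_words => /andP[/eqP sz2 _].
rewrite (@ncmul_homog a b) ?size_cat ?sz1 ?sz2 // take_size_cat // drop_size_cat //.
by rewrite mcontent_cat mpolyXD -scalerAl -scalerAr scalerA.
Qed.

(** Only the commutative image is required to be symmetric; a non-lifted function itself need not be
    invariant under permutations of places or letters. *)
Definition ncsymmetric n F := forall N, nceval N n F \is symmetric.

(** The coefficient of x^ka in as many variables as ka has parts. This fixes the number of
    variables, so that one value serves every N. *)
Definition shape_coef n F (ka : seq nat) : R :=
  \sum_(s <- words (size ka) n | mkseq (fun i => count_mem i s) (size ka) == ka) F s.

Lemma mcoeff_monomial_sym n N (ka : intpart n) m :
  (monomial_sym R N ka)@_m = (perm_eq [seq k <- m | (0 < k)%N] ka)%:R.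
Proof.
rewrite /monomial_sym raddf_sum /=.
under eq_bigr => i _ do rewrite mcoeffX.
have [pm|npm] := boolP (perm_eq _ ka); last first.
  rewrite big1 // => i pi; case: eqP => // e; move: npm; rewrite -e.
  by move: pi => ->.
have degm : (mdeg m < n.+1)%N.
  have /and3P[_ _ /eqP s] : is_part n ka := valP ka.
  by rewrite ltnS -s -(perm_sumn pm) sumn_mnm_pos.
rewrite (bigD1 (BMultinom degm)) /= ?pm // eqxx big1 ?addr0 // => i /andP[_ ne].
case: eqP => // e; case/negP: ne; apply/eqP/val_inj; exact: e.
Qed.

Lemma symmetric_perm N (p : {mpoly R[N]}) (m m' : 'X_{1..N}) :
  p \is symmetric -> perm_eq m m' -> p@_m = p@_m'.
Proof.
move=> /issymP sp /tuple_permP[s es]; rewrite -{2}(sp s) mcoeff_sym.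
congr (_@__); apply/mnmP => i; rewrite mnmE !mnm_tnth.
by rewrite (tnth_nth 0%N) es -tnth_nth tnth_mktuple.
Qed.

Lemma mem_filter_pos (s : seq nat) : 0%N \notin [seq k <- s | (0 < k)%N].
Proof. by rewrite mem_filter. Qed.

Lemma perm_pad0 (ka m : seq nat) : perm_eq [seq k <- m | (0 < k)%N] ka ->
  perm_eq m (ka ++ nseq (size m - size ka) 0%N).
Proof.
move=> pm; rewrite -(perm_filterC (fun k => (0 < k)%N) m); apply: perm_cat => //.
have -> : (size m - size ka)%N = size [seq k <- m | predC (fun k => (0 < k)%N) k].
  rewrite -(perm_size pm) !size_filter -(count_predC (fun k => (0 < k)%N) m).
  by rewrite addKn.
have /all_pred1P <- : all (pred1 0%N) [seq k <- m | predC (fun k => (0 < k)%N) k].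
  by apply/allP => k; rewrite mem_filter /= -eqn0Ngt => /andP[].
exact: perm_refl.
Qed.

(** By symmetry m may be replaced by ka padded with zeros, and words of that content use only
    letters below [size ka]. *)
Lemma mcoeff_nceval_shape n N F (ka : intpart n) (m : 'X_{1..N}) : ncsymmetric n F ->
  perm_eq [seq k <- m | (0 < k)%N] ka -> (nceval N n F)@_m = shape_coef n F ka.
Proof.
move=> sF pm; have pm' := perm_pad0 pm; rewrite size_tuple in pm'.
have le_N : (size ka <= N)%N.
  by rewrite -(perm_size pm) size_filter -[X in (_ <= X)%N](size_tuple m) count_size.
pose m' : 'X_{1..N} := [multinom nth 0%N ka i | i < N].
have em' : m' = ka ++ nseq (N - size ka) 0%N :> seq nat.
  apply: (@eq_from_nth _ 0%N) => [|i].
    by rewrite size_tuple size_cat size_nseq subnKC.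
  rewrite size_tuple => lt_i; rewrite -(tnth_nth _ _ (Ordinal lt_i)) -mnm_tnth mnmE /=.
  by rewrite nth_cat nth_nseq if_same; case: ltnP => // le_i; rewrite nth_default.
rewrite (symmetric_perm (sF N) (m' := m')); last by rewrite em'.
rewrite mcoeff_nceval /shape_coef -!(big_filter (words _ _)).
apply: perm_big; apply: uniq_perm; rewrite ?filter_uniq ?uniq_words // => s.
rewrite !mem_filter !mem_words; apply/and3P/and3P => -[] /eqP e sz lt_s; split=> //.
- apply/eqP/(@eq_from_nth _ 0%N) => [|i]; rewrite size_mkseq // => lt_i.
  have lt_iN := leq_trans lt_i le_N; rewrite nth_mkseq //.
  by have /mnmP/(_ (Ordinal lt_iN)) := e; rewrite mcontentE mnmE.
- apply/allP => c cs; rewrite ltnNge; apply/negP => le_c.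
  have /mnmP/(_ (Ordinal (allP lt_s _ cs))) := e.
  rewrite mcontentE mnmE /= nth_default // => /eqP.
  by rewrite -leqn0 leqNgt -has_count has_pred1 cs.
- apply/eqP/mnmP => i; rewrite mcontentE mnmE.
  have [lt_i|le_i] := ltnP i (size ka).
    by rewrite -[in RHS]e nth_mkseq.
  rewrite nth_default //; apply/count_memPn; apply/negP => /(allP lt_s).
  by rewrite ltnNge le_i.
- by apply: sub_all lt_s => c /leq_trans; apply.
Qed.

Definition mnm_part N (m : 'X_{1..N}) : seq nat := sort geq [seq k <- m | (0 < k)%N].

Lemma mnm_part_is_part N (m : 'X_{1..N}) : is_part (mdeg m) (mnm_part m).
Proof.
apply/and3P; split.
- by apply: sort_sorted => x y; exact: leq_total.
- by rewrite mem_sort mem_filter_pos.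
- by rewrite (perm_sumn (permEl (perm_sort _ _))) sumn_mnm_pos.
Qed.

Lemma intpart_perm_inj n (ka la : intpart n) : perm_eq ka la -> ka = la.
Proof.
have /and3P[ska _ _] : is_part n ka := valP ka.
have /and3P[sla _ _] : is_part n la := valP la.
move=> p; apply: val_inj; apply: (sorted_eq (leT := geq)) => //.
- by move=> x y z /= xy yz; apply: leq_trans yz xy.
- by move=> x y /andP[/= h1 h2]; apply/eqP; rewrite eqn_leq h1 h2.
Qed.

Lemma nceval_monomial_sym n N F : ncsymmetric n F ->
  nceval N n F = \sum_(ka : intpart n) shape_coef n F ka *: monomial_sym R N ka.
Proof.
move=> sF; apply/mpolyP => m; rewrite [RHS]raddf_sum /=.
under [RHS]eq_bigr => ka _ do rewrite mcoeffZ mcoeff_monomial_sym.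
have [dm|ndm] := eqVneq (mdeg m) n; last first.
  rewrite mcoeff_nceval_deg // big1 // => ka _.
  have [pm|] := boolP (perm_eq _ ka); last by rewrite mulr0.
  case/negP: ndm; apply/eqP.
  have /and3P[_ _ /eqP <-] : is_part n ka := valP ka.
  by rewrite -(perm_sumn pm) sumn_mnm_pos.
have pm := mnm_part_is_part m; rewrite dm in pm; pose ka0 := IntPart pm.
have pka : perm_eq [seq k <- m | (0 < k)%N] ka0 by rewrite perm_sym; apply/permEl/perm_sort.
rewrite (bigD1 ka0) //= pka mulr1 big1 ?addr0 => [|ka ne].
  exact: (mcoeff_nceval_shape sF pka).
case: (boolP (perm_eq _ ka)) => [pk|]; last by rewrite mulr0.
case/negP: ne; apply/eqP/intpart_perm_inj; apply: perm_trans pka.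
by rewrite perm_sym.
Qed.

End Evaluation.

(** * Commutative image of the non-lifted functions *)

Lemma tabs_flatten N n la : ispart la -> sumn la = n ->
  perm_eq [seq flatten T | T <- tabs N la]
          [seq s <- words N n | is_ssyt la (reshape la s)].
Proof.
move=> pla sla; have shT T : T \in tabs N la -> reshape la (flatten T) = T.
  by move=> iT; rewrite -(tabs_shape pla iT) flattenK.
apply: uniq_perm; last first.
- move=> s; rewrite mem_filter mem_words; apply/mapP/and3P.
    case=> T iT ->; rewrite (shT _ iT).
    have := iT; rewrite mem_tabs // => /andP[ssT entT].
    rewrite size_flatten (tabs_shape pla iT) sla eqxx; split=> //.
    apply/allP => c /flattenP[r rT cr]; exact: (allP (allP entT _ rT)).
  case=> ss /eqP sz ents; exists (reshape la s); last by rewrite reshapeKr ?sla ?sz.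
  rewrite mem_tabs // ss /=; apply/allP => r rR; apply/allP => c cr.
  by apply: (allP ents); rewrite -(@reshapeKr _ la s) ?sla ?sz //; apply/flattenP; exists r.
- by rewrite filter_uniq ?uniq_words.
rewrite map_inj_in_uniq ?uniq_tabs // => T T' iT iT' eqT.
by rewrite -(shT T) // eqT shT.
Qed.

Lemma nonliftedHL_homog nu n : sumn nu = n -> nchomog n (nonliftedHL nu).
Proof.
move=> <- s ns; rewrite /nonliftedHL; case: ifP => // /andP[/and3P[/eqP sh _ _] /eqP e].
by case/eqP: ns; rewrite -e size_flatten sh.
Qed.

Lemma sum_words_nonliftedHL N n nu (V : lmodType {poly int}) (g : seq nat -> V) :
  ispart nu -> sumn nu = n ->
  \sum_(s <- words N n) nonliftedHL nu s *: g s =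
  \sum_(T <- tabs N nu) psi T *: g (flatten T).
Proof.
move=> pnu snu.
transitivity (\sum_(s <- words N n | is_ssyt nu (reshape nu s)) psi (reshape nu s) *: g s).
  rewrite [RHS]big_mkcond; apply: eq_big_seq => s; rewrite mem_words => /andP[/eqP sz _].
  rewrite /nonliftedHL reshapeKr ?snu ?sz // eqxx andbT.
  by case: ifP => // _; rewrite scale0r.
rewrite -big_filter -(perm_big _ (tabs_flatten N pnu snu)) big_map.
by apply: eq_big_seq => T iT; rewrite -(tabs_shape pnu iT) flattenK.
Qed.

Lemma msym_var N (s : 'S_N) (i : 'I_N) :
  msym s ('X_i : {mpoly {poly int}[N]}) = 'X_(s i).
Proof.
rewrite msymX; congr 'X_[_]; apply/mnmP => j; rewrite mnmE !mnm1E.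
by rewrite -(inj_eq (@perm_inj _ s)) permKV.
Qed.

Lemma tofrac_msym_monomial N (s : 'S_N) w : all (fun c => (c < N)%N) w ->
  (msym s ('X_[mcontent N w] : {mpoly {poly int}[N]}))%:F =
  \prod_(c <- w) nth 0 [seq hlx (s i) | i <- enum 'I_N] c.
Proof.
elim: w => [_|c w IHw /andP[lt_c lt_w]].
  have -> : mcontent N [::] = 0%MM by apply/mnmP => i; rewrite [LHS]mcontentE [RHS]mnm0E.
  by rewrite big_nil mpolyX0 msym1 tofrac1.

rewrite (mcontent_cons (Ordinal lt_c)) mpolyXD msymM tofracM msym_var IHw // big_cons.
congr (_ * _); rewrite (nth_map (Ordinal lt_c)) ?size_enum_ord //.
by congr (hlx (s _)); apply: val_inj; rewrite /= nth_enum_ord.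
Qed.

(** Permuting the variables permutes the list at which the tableau formula is evaluated. The
    identity permutation gives P_nu; a general s gives symmetry, since [hl_R] ignores the order of
    the list. *)
Lemma tofrac_msym_nceval N (s : 'S_N) nu n : ispart nu -> sumn nu = n ->
  (msym s (nceval N n (nonliftedHL nu)))%:F =
  (hl_norm (hlc N) nu)^-1 * hl_R (hlt N) nu [seq hlx (s i) | i <- enum 'I_N].
Proof.
move=> pnu snu; rewrite /nceval sum_words_nonliftedHL //.
have x_inj : injective (fun i => hlx (s i)) by move=> i j /hlx_inj/perm_inj.
have Uxs : uniq [seq hlx (s i) | i <- enum 'I_N] by rewrite (map_inj_uniq x_inj) enum_uniq.
have := hl_R_tableaux (@hlc_qint_neq0 N) pnu Uxs; rewrite hlc_X => ->.
rewrite mulKf ?hl_norm_neq0 //; last by move=> m; apply: hlc_qint_neq0.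
rewrite size_map size_enum_ord (big_morph (msym s) (@msymD _ _ s) (@msym0 _ _ s)).
rewrite (big_morph _ (@tofracD _) (@tofrac0 _)); apply: eq_big_seq => T.
rewrite mem_tabs // => /andP[_ entT] /=.
rewrite msymZ -mul_mpolyC tofracM tofrac_msym_monomial //.
by apply/allP => c /flattenP[r rT cr]; apply: (allP (allP entT _ rT)).
Qed.

Lemma HL_nceval N nu n : ispart nu -> sumn nu = n ->
  HL N nu = (nceval N n (nonliftedHL nu))%:F.
Proof.
move=> pnu snu; have := tofrac_msym_nceval (1%g : 'S_N) pnu snu.
rewrite msym1m => ->; rewrite HLE; last by case/andP: pnu.
by congr (_ * hl_R _ _ _); apply: eq_map => i; rewrite perm1.
Qed.

Lemma nonliftedHL_symmetric nu n : ispart nu -> sumn nu = n ->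
  ncsymmetric n (nonliftedHL nu).
Proof.
move=> pnu snu N; apply/issymP => s; apply/eqP; rewrite -tofrac_eq; apply/eqP.
rewrite tofrac_msym_nceval // -(HL_nceval _ pnu snu) HLE; last by case/andP: pnu.
congr (_ * _); apply: hl_R_perm; rewrite (map_comp (@hlx N) s) perm_map //.
apply: uniq_perm; rewrite ?(map_inj_uniq perm_inj) ?enum_uniq // => i.
rewrite mem_enum inE; apply/mapP; exists ((s^-1)%g i); rewrite ?mem_enum //.
by rewrite permKV.
Qed.

Lemma intpart_ispart n (la : intpart n) : ispart la.
Proof. by have /and3P[sla n0 _] : is_part n la := valP la; rewrite /ispart sla. Qed.

Lemma intpart_sumn n (la : intpart n) : sumn la = n.
Proof. by have /and3P[_ _ /eqP] : is_part n la := valP la. Qed.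

Lemma intpart_size n (la : intpart n) : (size la <= n)%N.
Proof.
rewrite -[leqRHS](intpart_sumn la); apply: size_leq_sumn.
by have /andP[] := intpart_ispart la.
Qed.

(** * Unitriangularity for dominance *)

Lemma ssyt_entry_ge nu T i j : ispart nu -> is_ssyt nu T -> (j < nth 0 nu i)%N ->
  (i <= nth 0 (nth [::] T i) j)%N.
Proof.
move=> pnu /is_ssytP[_ _ cT]; elim: i => // i IHi lt_j.
apply: leq_ltn_trans (cT _ _ lt_j); apply: IHi.
by apply: leq_trans lt_j _; apply: ispart_nth_le.
Qed.

Lemma sumn_mkseq_count s k :
  sumn (mkseq (fun i => count_mem i s) k) = count (fun c => (c < k)%N) s.
Proof.
elim: k => [|k IHk]; first by rewrite (eq_count (a2 := pred0)) ?count_pred0.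
rewrite mkseqS sumn_rcons IHk; elim: s {IHk} => //= c s <-.
by rewrite ltnS; case: (ltngtP c k) => /=; lia.
Qed.

(** Entries of row i are at least i, so letters below k occur only in the first k rows. *)
Lemma count_lt_flatten k (T : seq (seq nat)) nu : ispart nu -> is_ssyt nu T ->
  count (fun c => (c < k)%N) (flatten T) = count (fun c => (c < k)%N) (flatten (take k T)).
Proof.
move=> pnu ssT; have /is_ssytP[sT _ _] := ssT.
rewrite -{1}(cat_take_drop k T) flatten_cat count_cat -[RHS]addn0; congr (_ + _)%N.
apply/eqP; rewrite -leqn0 leqNgt -has_count; apply/hasPn => c /flattenP[r].
case/(nthP [::]) => i _ <-; rewrite nth_drop => /(nthP 0%N)[j lt_j <-].
rewrite -leqNgt; apply: leq_trans (leq_addr i k) _.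
by apply: ssyt_entry_ge pnu ssT _; rewrite -sT nth_shape.
Qed.

Lemma size_flatten_take k (T : seq (seq nat)) nu : shape T = nu ->
  size (flatten (take k T)) = sumn (take k nu).
Proof. by move=> <-; rewrite size_flatten /shape map_take. Qed.

Lemma sumn_take_content (ka s : seq nat) k :
  mkseq (fun i => count_mem i s) (size ka) = ka ->
  sumn (take k ka) = count (fun c => (c < minn k (size ka))%N) s.
Proof.
move=> <-; rewrite size_mkseq -sumn_mkseq_count.
rewrite /mkseq -map_take; congr (sumn (map _ _)).
by rewrite take_iota.
Qed.

Lemma dominatesP n (la mu : intpart n) :
  reflect (forall k, (sumn (take k mu) <= sumn (take k la))%N) (dominates la mu).
Proof.
apply: (iffP allP) => [H k|H k _]; last exact: H.
have [lt_k|le_k] := ltnP k n.+1.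
  by apply: H; rewrite mem_iota intpart_sumn.
by rewrite !take_oversize ?intpart_sumn // (leq_trans (intpart_size _)) // ltnW.
Qed.

(** In a tableau of content ka, the ka_1 + ... + ka_k letters below k must fit into the first k rows
    of la. *)
Lemma shape_coef_dominates n (la ka : intpart n) :
  shape_coef n (nonliftedHL la) ka != 0 -> dominates la ka.
Proof.
move=> nz; apply/dominatesP => k; rewrite leqNgt; apply: contra_neqN nz => lt_k.
rewrite /shape_coef big1 // => s /eqP cs; rewrite /nonliftedHL.
case: ifP => // /andP[ssT /eqP fT]; move: lt_k; rewrite (sumn_take_content k cs) ltnNge.
case/negP; have /is_ssytP[sT _ _] := ssT.
rewrite -(size_flatten_take k sT).
apply: leq_trans (count_size (fun c => (c < k)%N) _).
rewrite -(count_lt_flatten k (intpart_ispart la) ssT) fT.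
by apply: sub_count => c /= /leq_trans; apply; rewrite geq_minl.
Qed.

(** The only tableau of shape la whose content is la; it accounts for the diagonal coefficient 1. *)
Definition row_tab (la : seq nat) := mkseq (fun i => nseq (nth 0%N la i) i) (size la).

Lemma nth_row_tab la i : nth [::] (row_tab la) i = nseq (nth 0%N la i) i.
Proof.
have [lt_i|le_i] := ltnP i (size la); first by rewrite nth_mkseq.
by rewrite nth_default ?size_mkseq // (nth_default 0%N le_i).
Qed.

Lemma shape_row_tab la : shape (row_tab la) = la.
Proof.
apply: (@eq_from_nth _ 0%N); rewrite size_map size_mkseq // => i _.
by rewrite nth_shape nth_row_tab size_nseq.
Qed.

Lemma row_tab_ssyt la : ispart la -> is_ssyt la (row_tab la).
Proof.
move=> pla; apply/is_ssytP; split; first exact: shape_row_tab.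
  move=> r /mapP[i _ ->]; elim: (nth _ _ _) => //= -[|k] //= ->.
  by rewrite leqnn.
move=> i j lt_j; rewrite !nth_row_tab !nth_nseq lt_j.
by rewrite (leq_trans lt_j (ispart_nth_le i pla)).
Qed.

(** The first k rows have as many boxes as there are letters below k, and all these letters lie
    there. So entries of row i are at most i, while column strictness makes them at least i. *)
Lemma row_tab_unique la T : ispart la -> is_ssyt la T ->
  mkseq (fun i => count_mem i (flatten T)) (size la) = la -> T = row_tab la.
Proof.
move=> pla ssT cT; have /is_ssytP[sT rT _] := ssT.
have szT : size T = size la by rewrite -sT size_map.
have small k : (k <= size la)%N -> all (fun c => (c < k)%N) (flatten (take k T)).
  move=> le_k; rewrite all_count (size_flatten_take k sT) (sumn_take_content k cT).
  by rewrite (minn_idPl le_k) (count_lt_flatten k pla ssT).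
apply: (@eq_from_nth _ [::]) => [|i lt_i]; first by rewrite size_mkseq.
rewrite nth_row_tab -sT nth_shape; apply/all_pred1P/allP => c /(nthP 0%N)[j lt_j <-] /=.
rewrite szT in lt_i; rewrite eqn_leq (ssyt_entry_ge pla ssT) ?andbT -?sT ?nth_shape //.
rewrite -ltnS; apply: (allP (small i.+1 lt_i)); apply/flattenP.
exists (nth [::] T i); last exact: mem_nth.
rewrite -(nth_take [::] (ltnSn i)); apply: mem_nth.
by rewrite size_takel ?szT.
Qed.

Lemma content_row_tab la : mkseq (fun i => count_mem i (flatten (row_tab la))) (size la) = la.
Proof.
apply: (@eq_from_nth _ 0%N); rewrite size_mkseq // => i lt_i.
rewrite nth_mkseq // count_flatten sumnE big_map big_map.
rewrite (bigD1_seq i) ?mem_iota ?iota_uniq //=.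
rewrite count_nseq /= eqxx mul1n big1 ?addn0 // => j ne_j.
by rewrite count_nseq /= (negPf ne_j).
Qed.

Lemma row_tab_words la : ispart la -> flatten (row_tab la) \in words (size la) (sumn la).
Proof.
move=> pla; rewrite mem_words size_flatten shape_row_tab eqxx /=.
apply/allP => c /flattenP[r /mapP[i + ->]]; rewrite mem_iota mem_nseq.
by move=> /andP[_ lt_i] /andP[_ /eqP->].
Qed.

(** The strip is a whole new bottom row. Its columns form an initial segment, so no empty column is
    followed by a nonempty one. *)
Lemma psi_skew_take la i : (i < size la)%N -> psi_skew (take i.+1 la) (take i la) = 1.
Proof.
move=> lt_i; rewrite /psi_skew big1_seq // => j /andP[/andP[nj sj]].
rewrite mem_index_iota => /andP[j_gt0 _]; case/negP: nj.
case/skew_colP: sj => k; rewrite size_takel // => lt_k /andP[H1 H2].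
apply/skew_colP; exists k; first by rewrite size_takel.
rewrite (ltnW H2) andbT; move: H1 H2; rewrite (nth_take 0%N lt_k).
have [lt_ki|le_ki] := ltnP k i.
  by rewrite nth_take // => H1 H2; have := leq_trans H1 H2; rewrite ltnn.
by rewrite nth_default // size_takel // ltnW.
Qed.

Lemma subshape_row_tab la a : ispart la -> (a < size la)%N ->
  subshape (row_tab la) a = take a.+1 la.
Proof.
move=> /andP[_ n0] lt_a; rewrite /subshape /row_tab -map_comp.
rewrite (@eq_map _ _ _ (fun i => (i <= a)%N * nth 0%N la i)%N) => [|i /=]; last first.
  by rewrite count_nseq.
rewrite -(subnKC lt_a) iotaD map_cat filter_cat add0n.
have -> : [seq ((i <= a) * nth 0 la i)%N | i <- iota 0 a.+1] =
    [seq nth 0%N la i | i <- iota 0 a.+1].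
  by apply/eq_in_map => i; rewrite mem_iota ltnS => /andP[_ ->]; rewrite mul1n.
rewrite map_nth_iota0 // -[RHS]cats0; congr (_ ++ _).
  apply/all_filterP/allP => k /mem_take; rewrite lt0n.
  by apply: contraTneq => ->.
rewrite filter_map (@eq_in_filter _ _ pred0) ?filter_pred0 // => i.
by rewrite mem_iota /= => /andP[lt_i _]; rewrite (ltn_geF lt_i).
Qed.

Lemma psi_row_tab la : ispart la -> psi (row_tab la) = 1.
Proof.
move=> pla; have chE : ssyt_chain (row_tab la) = [seq take i la | i <- iota 0 (size la).+1].
  rewrite /ssyt_chain /= take0; congr cons.
  have -> : sort leq (undup (flatten (row_tab la))) = iota 0 (size la).
    apply: (sorted_eq leq_trans anti_leq).
    - by apply: sort_sorted; exact: leq_total.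
    - exact: iota_sorted.
    rewrite perm_sort; apply: uniq_perm; rewrite ?undup_uniq ?iota_uniq // => c.
    rewrite mem_undup mem_iota /=; apply/flattenP/idP => [[r /mapP[i + ->]]|lt_c].
      by rewrite mem_iota mem_nseq => /andP[_ lt_i] /andP[_ /eqP->].
    exists (nseq (nth 0%N la c) c); last first.
      rewrite mem_nseq eqxx andbT lt0n; have /andP[_] := pla; apply: contraNneq => <-.
      exact: mem_nth.
    by apply/mapP; exists c; rewrite // mem_iota.
  rewrite (iotaDl 1 0) -map_comp; apply/eq_in_map => i; rewrite mem_iota => /andP[_ lt_i].
  by rewrite /= subshape_row_tab.
have nthE k : (k < (size la).+1)%N ->
    nth [::] [seq take i la | i <- iota 0 (size la).+1] k = take k la.
  by move=> lt_k; rewrite (nth_map 0%N) ?size_iota // nth_iota.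
rewrite /psi chE big1 // => i _.
have lt_i : (i < size la)%N.
  by apply: leq_trans (ltn_ord i) _; rewrite size_map size_iota.
by rewrite !nthE ?psi_skew_take // ltnS ltnW.
Qed.

Lemma shape_coef_diag n (la : intpart n) : shape_coef n (nonliftedHL la) la = 1.
Proof.
have pla := intpart_ispart la; set s0 := flatten (row_tab la).
have i0 : s0 \in words (size la) n by rewrite -{2}(intpart_sumn la) row_tab_words.
have resh0 : reshape la s0 = row_tab la by rewrite -{1}(shape_row_tab la) flattenK.
rewrite /shape_coef big_mkcond (bigD1_seq s0) ?uniq_words //=.
rewrite content_row_tab eqxx /nonliftedHL resh0 row_tab_ssyt // eqxx psi_row_tab //.
rewrite big1 ?addr0 // => s ne_s; case: ifP => // /eqP cs; case: ifP => // /andP[ssT /eqP fT].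
by case/eqP: ne_s; rewrite -fT (row_tab_unique pla ssT) // fT.
Qed.

(** A numerical height that increases strictly along dominance, so that triangular systems can be
    solved by induction on a natural number. *)
Definition dom_stat n (la : seq nat) := \sum_(k < n.+1) sumn (take k la).

Lemma ispart_eq_nth la mu : ispart la -> ispart mu ->
  (forall i, nth 0%N la i = nth 0%N mu i) -> la = mu.
Proof.
elim: la mu => [|a la IHla] [|b mu] // pla pmu H.
- by have := H 0%N; move: pmu; rewrite ispart_cons => /and3P[+ _ _] /= e; rewrite -e.
- by have := H 0%N; move: pla; rewrite ispart_cons => /and3P[+ _ _] /= e; rewrite e.
have /= -> := H 0%N; congr cons; apply: IHla => [||i]; last exact: (H i.+1).
  by move: pla; rewrite ispart_cons => /and3P[].
by move: pmu; rewrite ispart_cons => /and3P[].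
Qed.

Lemma sumn_takeS (s : seq nat) k : sumn (take k.+1 s) = (sumn (take k s) + nth 0 s k)%N.
Proof.
have [lt_k|le_k] := ltnP k (size s); first by rewrite (take_nth 0%N) // sumn_rcons.
by rewrite nth_default // addn0 !take_oversize // ltnW.
Qed.

Lemma dominates_stat n (la mu : intpart n) : dominates la mu ->
  la = mu \/ (dom_stat n mu < dom_stat n la)%N.
Proof.
move/dominatesP => H; have [lt_f|ge_f] := ltnP (dom_stat n mu) (dom_stat n la); first by right.
left; have le_f k (kn : (k < n.+1)%N) : sumn (take k mu) = sumn (take k la).
  apply/eqP; rewrite eqn_leq H /= leqNgt; apply/negP => lt_k.
  move: ge_f; rewrite leqNgt => /negP; apply; rewrite /dom_stat.
  rewrite (bigD1 (Ordinal kn)) //= [X in (_ < X)%N](bigD1 (Ordinal kn)) //=.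
  by rewrite -addSn leq_add // leq_sum.
apply: val_inj; apply: ispart_eq_nth; try exact: intpart_ispart.
move=> i; have [lt_i|le_i] := ltnP i n.
  have := le_f i.+1 lt_i; rewrite !sumn_takeS le_f ?ltnS ?(ltnW lt_i) //.
  by move/addnI.
have sz (la' : intpart n) : (size la' <= i)%N.
  exact: leq_trans (intpart_size la') le_i.
by rewrite (nth_default 0%N (sz la)) (nth_default 0%N (sz mu)).
Qed.

(** * Unitriangular systems over a ring *)

Section Unitriangular.
Variables (I : finType) (R : nzRingType) (f : I -> nat) (c : I -> I -> R).
Hypothesis c_diag : forall i, c i i = 1.
Hypothesis c_lt : forall i j, c i j != 0 -> i = j \/ (f j < f i)%N.

Let c_ge i j : i != j -> (f i <= f j)%N -> c i j = 0.
Proof.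
move=> ne_ij le_ij; apply/eqP; apply: contraTT le_ij => /c_lt[e|].
  by rewrite e eqxx in ne_ij.
by rewrite -ltnNge.
Qed.

(** Induction on a bound for f on the support of d: subtracting the combination given by the top
    layer f i = B, on which c is the identity, lowers the bound. *)
Lemma unitriangular_solve d : exists e, forall j, d j = \sum_i e i * c i j.
Proof.
have [B HB] : exists B, forall j, d j != 0 -> (f j < B)%N.
  by exists (\max_i f i).+1 => j _; rewrite ltnS (leq_bigmax j).
elim: B d HB => [|B IHB] d HB.
  exists (fun=> 0) => j; rewrite big1 => [|i _]; last by rewrite mul0r.
  by apply/eqP; rewrite -[_ == _]negbK; apply/negP => /HB.
pose e0 i := if f i == B then d i else 0.
have [j|e He] := IHB (fun j => d j - \sum_i e0 i * c i j).
  apply: contraR; rewrite -leqNgt => le_B.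
  rewrite (bigD1 j) //= c_diag mulr1 big1 ?addr0 => [|i ne_i].
    rewrite /e0; have [_|ne_B] := eqVneq (f j) B; first by rewrite subrr.
    rewrite subr0; apply: contraTT le_B => /HB; rewrite ltnS -ltnNge.
    by rewrite leq_eqVlt (negPf ne_B).
  rewrite /e0; case: eqP => [fi|]; last by rewrite mul0r.
  by rewrite c_ge ?mulr0 // fi.
exists (fun i => e i + e0 i) => j.
under eq_bigr => i _ do rewrite mulrDl.
by rewrite big_split /= -He subrK.
Qed.

(** Besides e i, the equation at i involves only e j with f j > f i, so the unknowns vanish in order
    of decreasing f. *)
Lemma unitriangular_inj e : (forall j, \sum_i e i * c i j = 0) -> forall i, e i = 0.
Proof.
move=> He; have [B HB] : exists B, forall i, (f i < B)%N.
  by exists (\max_i f i).+1 => i; rewrite ltnS (leq_bigmax i).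
suff H k i : (B - f i <= k)%N -> e i = 0 by move=> i; apply: (H (B - f i)%N).
elim: k i => [|k IHk] i; first by rewrite leqn0 subn_eq0 leqNgt HB.
move=> le_k; have := He i; rewrite (bigD1 i) //= c_diag mulr1 big1 ?addr0 // => j ne_j.
have [lt_f|ge_f] := ltnP (f i) (f j); last by rewrite c_ge ?mulr0.
by rewrite IHk ?mul0r //; have := HB j; lia.
Qed.

End Unitriangular.

(** * Structure constants *)

Definition HLpoly N n (la : intpart n) : {mpoly {poly int}[N]} :=
  nceval N n (nonliftedHL la).

Lemma HL_poly N n (la : intpart n) : HL N la = (HLpoly N la)%:F.
Proof. exact: HL_nceval (intpart_ispart la) (intpart_sumn la). Qed.

Lemma HLpoly_sym n (la : intpart n) : ncsymmetric n (nonliftedHL la).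
Proof. exact: nonliftedHL_symmetric (intpart_ispart la) (intpart_sumn la). Qed.

Lemma nonliftedHL_intpart_homog n (la : intpart n) : nchomog n (nonliftedHL la).
Proof. exact: nonliftedHL_homog (intpart_sumn la). Qed.

Lemma tofrac_sum (A : idomainType) (I : Type) (r : seq I) (P : pred I) (g : I -> A) :
  (\sum_(i <- r | P i) g i)%:F = \sum_(i <- r | P i) (g i)%:F.
Proof. exact: (big_morph _ (@tofracD _) (@tofrac0 _)). Qed.

(** The [epsilon] choice acquires its defining property from the witness [shape_coef], which does
    not depend on N. *)
Lemma hl_monomial_coefP n (la : intpart n) :
  is_hl_monomial_expansion la (hl_monomial_coef la).
Proof.
apply: epsilon_spec; exists (shape_coef n (nonliftedHL la)) => N.
rewrite HL_poly /HLpoly (nceval_monomial_sym _ (HLpoly_sym la)); congr (_%:F).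
rewrite [RHS]big_mkcond; apply: eq_bigr => ka _; case: ifPn => // ndom.
have [->|/shape_coef_dominates dom] := eqVneq (shape_coef n (nonliftedHL la) ka) 0.
  by rewrite scale0r.
by rewrite dom in ndom.
Qed.

Lemma HLpolyE N n (la : intpart n) : HLpoly N la =
  \sum_(mu : intpart n | dominates la mu) hl_monomial_coef la mu *: monomial_sym _ N mu.
Proof. by apply/eqP; rewrite -tofrac_eq -HL_poly; apply/eqP/hl_monomial_coefP. Qed.

Lemma shape_coef_lt n (la ka : intpart n) : shape_coef n (nonliftedHL la) ka != 0 ->
  la = ka \/ (dom_stat n ka < dom_stat n la)%N.
Proof. by move/shape_coef_dominates/dominates_stat. Qed.

Lemma nceval_HLpoly_expansion n F : ncsymmetric n F ->
  exists e : intpart n -> {poly int}, forall N,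
    nceval N n F = \sum_(la : intpart n) e la *: HLpoly N la.
Proof.
move=> sF.
have [e He] := unitriangular_solve (@shape_coef_diag n) (@shape_coef_lt n) (fun ka => shape_coef n F ka).
exists e => N; rewrite nceval_monomial_sym //.
under [RHS]eq_bigr => la _ do
  rewrite /HLpoly (nceval_monomial_sym _ (HLpoly_sym la)) scaler_sumr.
rewrite exchange_big; apply: eq_bigr => ka _ /=; rewrite He scaler_suml.
by apply: eq_bigr => la _; rewrite scalerA.
Qed.

(** The concatenation product of the two non-lifted functions has commutative image P_mu P_nu, so
    that the expansion of symmetric images supplies a witness over Z[t] common to all N. *)
Lemma hl_coefP n r (mu : intpart (n - r)) (nu : intpart r) : (r <= n)%N ->
  is_hl_product_expansion mu nu (@hl_coef n mu nu).
Proof.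
move=> le_r; apply: epsilon_spec.
have prodE N : nceval N n (ncmul (nonliftedHL mu) (nonliftedHL nu)) =
    HLpoly N mu * HLpoly N nu.
  by rewrite -{1}(subnK le_r) nceval_mul //; apply: nonliftedHL_intpart_homog.
have [N|e He] := @nceval_HLpoly_expansion n (ncmul (nonliftedHL mu) (nonliftedHL nu)).
  by rewrite prodE rpredM //; apply: HLpoly_sym.
exists e => N; rewrite !HL_poly -tofracM -prodE He tofrac_sum; apply: eq_bigr => la _.
by rewrite -mul_mpolyC tofracM HL_poly.
Qed.

Lemma HLpoly_mul N n r (mu : intpart (n - r)) (nu : intpart r) : (r <= n)%N ->
  HLpoly N mu * HLpoly N nu = \sum_(la : intpart n) hl_coef mu nu la *: HLpoly N la.
Proof.
move=> le_r; apply/eqP; rewrite -tofrac_eq tofracM -!HL_poly hl_coefP // tofrac_sum.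
by apply/eqP/eq_bigr => la _; rewrite -mul_mpolyC tofracM HL_poly.
Qed.

(** * Specialization at t = 0 *)

Lemma psi_skew_at0 al be : (psi_skew al be).[0] = 1.
Proof.
rewrite /psi_skew horner_prod big1_seq // => j /andP[/andP[nj sj]].
rewrite mem_index_iota => /andP[j_gt0 _].
(* A box in column j + 1 of row i, with column j empty, forces be_i = j. The exponent of 'X is then
   positive and the factor has constant term 1. *)
suff jbe : (0 < count_mem j be)%N by rewrite hornerD hornerN hornerXn hornerE expr0n gtn_eqF ?subr0.
rewrite -has_count has_pred1; case/skew_colP: sj => i lt_i /andP[H1 H2].
have e : nth 0%N be i = j.
  apply/eqP; rewrite eqn_leq -ltnS H1 leqNgt; apply: contra nj => H3.
  by apply/skew_colP; exists i; rewrite ?H3 ?(ltnW H2).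
rewrite -e; apply: mem_nth; rewrite ltnNge; apply/negP => le_i.
by rewrite nth_default // in e; rewrite -e in j_gt0.
Qed.

Lemma psi_at0 T : (psi T).[0] = 1.
Proof. by rewrite /psi horner_prod big1 // => i _; exact: psi_skew_at0. Qed.

Lemma words_tuple N n : perm_eq [seq map val w | w : n.-tuple 'I_N] (words N n).
Proof.
apply: uniq_perm; rewrite ?uniq_words //.
  rewrite map_inj_uniq ?enum_uniq // => w w' /(inj_map val_inj) e.
  exact: val_inj.
move=> s; rewrite mem_words; apply/mapP/andP => [[w _ ->]|[/eqP sz lt_s]].
  rewrite size_map size_tuple; split=> //; apply/allP => c /mapP[i _ ->].
  exact: ltn_ord.
have es : map val (pmap (@insub nat (fun c => (c < N)%N) 'I_N) s) = s.
  rewrite (pmap_filter (insubK _)); apply/all_filterP.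
  by apply/allP => c /(allP lt_s) lt_c; rewrite isSome_insub.
have szw : size (pmap (@insub nat (fun c => (c < N)%N) 'I_N) s) == n.
  by rewrite -(size_map val) es sz.
by exists (Tuple szw); rewrite ?mem_enum.
Qed.

Lemma mcontent_map_val N (w : seq 'I_N) :
  \prod_(i <- w) ('X_i : {mpoly int[N]}) = 'X_[mcontent N (map val w)].
Proof.
elim: w => [|i w IHw]; last by rewrite big_cons IHw /= mcontent_cons mpolyXD.
rewrite big_nil (_ : mcontent N _ = 0%MM) ?mpolyX0 //.
Qed.

Definition at0 : {rmorphism {poly int} -> int} := horner_eval (0 : int).

Lemma at0E p : at0 p = p.[0]. Proof. by []. Qed.

Lemma schur_HLpoly N n (la : intpart n) : schur N la = map_mpoly at0 (HLpoly N la).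
Proof.
rewrite /schur; move: (intpart_sumn la) => sla.
transitivity (\sum_(s <- words N (sumn la) | is_ssyt la (reshape la s))
    ('X_[mcontent N s] : {mpoly int[N]})).
  rewrite -(perm_big _ (words_tuple N (sumn la))) big_map enumT.
  by apply: eq_bigr => w _; rewrite mcontent_map_val.
rewrite sla /HLpoly /nceval rmorph_sum [LHS]big_mkcond; apply: eq_big_seq => s.
rewrite mem_words => /andP[/eqP sz _] /=.
rewrite map_mpolyZ map_mpolyX /nonliftedHL reshapeKr ?sla ?sz // eqxx andbT /=.
case: ifP => _; first by rewrite at0E psi_at0 scale1r.
by rewrite at0E horner0 scale0r.
Qed.

Lemma hl_coef_at0P n r (mu : intpart (n - r)) (nu : intpart r) : (r <= n)%N ->
  is_schur_product_expansion mu nu (fun la : intpart n => (hl_coef mu nu la).[0]).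
Proof.
move=> le_r N; rewrite !schur_HLpoly -rmorphM HLpoly_mul // rmorph_sum.
by apply: eq_bigr => la _; rewrite /= map_mpolyZ schur_HLpoly.
Qed.

Lemma mcoeff_monomial_sym_intpart (R : comNzRingType) n (ka la : intpart n) :
  (monomial_sym R n ka)@_[multinom nth 0%N la i | i < n] = (ka == la)%:R.
Proof.
rewrite mcoeff_monomial_sym; congr (_ : bool)%:R.
have sz := intpart_size la.
have -> : [seq k <- [multinom nth 0%N la i | i < n] | (0 < k)%N] = la :> seq nat.
  rewrite (_ : ([multinom nth 0%N la i | i < n] : seq nat) = la ++ nseq (n - size la) 0%N).
    rewrite filter_cat (_ : [seq k <- nseq _ _ | _] = [::]); last first.
      by elim: (n - _)%N.
    rewrite cats0; apply/all_filterP/allP => k kla; rewrite lt0n.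
    by apply: contraTneq kla => ->; have /andP[] := intpart_ispart la.
  apply: (@eq_from_nth _ 0%N) => [|i].
    by rewrite size_tuple size_cat size_nseq subnKC.
  rewrite size_tuple => lt_i; rewrite -(tnth_nth _ _ (Ordinal lt_i)) -mnm_tnth mnmE /=.
  by rewrite nth_cat nth_nseq if_same; case: ltnP => // le_i; rewrite nth_default.
apply/idP/eqP => [p|->]; last exact: perm_refl.
by apply: intpart_perm_inj; rewrite perm_sym.
Qed.

Lemma schur_linear_inj n (a b : intpart n -> int) :
  (forall N, \sum_(la : intpart n) a la *: schur N la =
             \sum_(la : intpart n) b la *: schur N la) -> a =1 b.
Proof.
move=> H la; apply/eqP; rewrite -subr_eq0; apply/eqP; move: la.
pose c (la ka : intpart n) := at0 (shape_coef n (nonliftedHL la) ka).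
apply: (unitriangular_inj (f := fun la : intpart n => dom_stat n la) (c := c)).
- by move=> la; rewrite /c shape_coef_diag rmorph1.
- move=> la ka; rewrite /c => nz; apply: shape_coef_lt.
  by apply: contraNneq nz => ->; rewrite rmorph0.
(* With n variables every partition of n gives a monomial, and the coefficients of this one form the
   column ka of the unitriangular matrix c. *)
move=> ka; pose m := [multinom nth 0%N ka i | i < n].
have cE (la : intpart n) : (schur n la)@_m = c la ka.
  rewrite schur_HLpoly mcoeff_map_mpoly /HLpoly (nceval_monomial_sym _ (HLpoly_sym la)).
  rewrite raddf_sum /= (bigD1 ka) //= mcoeffZ mcoeff_monomial_sym_intpart eqxx mulr1.
  rewrite big1 ?addr0 // => la' ne; rewrite mcoeffZ mcoeff_monomial_sym_intpart.
  by rewrite (negPf ne) mulr0.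
have coefE (d : intpart n -> int) :
    (\sum_(la : intpart n) d la *: schur n la)@_m = \sum_(la : intpart n) d la * c la ka.
  by rewrite raddf_sum; apply: eq_bigr => la _; rewrite /= mcoeffZ cE.
under eq_bigr => la _ do rewrite mulrBl.
by rewrite sumrB -!coefE H subrr.
Qed.

(** Both sides are structure constants of the Schur polynomials, the right one chosen by [epsilon];
    linear independence identifies them. *)
Lemma hl_coef_at0 n r (mu : intpart (n - r)) (nu : intpart r) (la : intpart n) :
  (r <= n)%N -> (hl_coef mu nu la).[0] = lr_coef mu nu la.
Proof.
move=> le_r; have H0 := hl_coef_at0P mu nu le_r.
have H1 : is_schur_product_expansion mu nu (@lr_coef n mu nu).
  by apply: epsilon_spec; exists (fun la => (hl_coef mu nu la).[0]).
move: la; apply: schur_linear_inj => N; by rewrite -H0 -H1.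
Qed.

(** * The star product *)

Section StarTransversal.
Variable n : nat.

(** The copy of S_k in S_n that acts on the first k points. *)
Definition fix_ge k : {set 'S_n} := [set p : 'S_n | [forall j : 'I_n, (k <= j)%N ==> (p j == j)]].

Lemma fix_geP k (p : 'S_n) :
  reflect (forall j : 'I_n, (k <= j)%N -> p j = j) (p \in fix_ge k).
Proof.
rewrite inE; apply: (iffP forallP) => H j; first by move/(implyP (H j))/eqP.
by apply/implyP => /H/eqP.
Qed.

Lemma fix_ge_lt k (p : 'S_n) (j : 'I_n) : p \in fix_ge k -> (j < k)%N -> (p j < k)%N.
Proof.
move/fix_geP => fp lt_j; rewrite ltnNge; apply/negP => le_k.
by have /perm_inj e := fp _ le_k; rewrite e leqNgt lt_j in le_k.
Qed.

Lemma fix_geV k (p : 'S_n) : p \in fix_ge k -> (p^-1)%g \in fix_ge k.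
Proof. by move/fix_geP=> fp; apply/fix_geP => j le_j; rewrite -{1}(fp j le_j) permK. Qed.

Lemma card_ord_lt k : (k <= n)%N -> #|[set j : 'I_n | (j < k)%N]| = k.
Proof.
by move=> le_k; rewrite -sum1dep_card -(big_ord_widen _ (fun=> 1%N) le_k) sum1_card card_ord.
Qed.

Lemma card_fix_ge k : (k <= n)%N -> #|fix_ge k| = k`!.
Proof.
move=> le_k; have -> : fix_ge k = [set p | perm_on [set j : 'I_n | (j < k)%N] p].
  apply/setP => p; rewrite [RHS]inE; apply/fix_geP/subsetP => H j.
    by rewrite !inE; apply: contraR; rewrite -leqNgt => /H->.
  move=> le_j; apply/eqP; apply: contraTT le_j => ne_j.
  by have := H j ne_j; rewrite inE -ltnNge.
by rewrite cardsE card_perm card_ord_lt.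
Qed.

Definition star_prod m (f : {ffun 'I_n -> 'I_n}) : 'S_n :=
  (\prod_(j < n | (m <= j)%N) tperm (f j) j)%g.

(** Indexed by natural numbers, so that products over intervals can lose their last factor. *)
Definition tperm_at (f : {ffun 'I_n -> 'I_n}) (j : nat) : 'S_n :=
  if insub j is Some i then tperm (f i) i else 1%g.

Lemma star_prodE m f : star_prod m f = (\prod_(m <= j < n) tperm_at f j)%g.
Proof.
rewrite [RHS]big_geq_mkord /=; apply: eq_bigr => j _.
by rewrite /tperm_at valK.
Qed.

(** Descent on k: since products compose from left to right, multiplying p on the right by the
    transposition of p (k-1) and k-1 makes it fix k-1. *)
Lemma fix_ge_factor m k (p : 'S_n) : (m <= k <= n)%N -> p \in fix_ge k ->
  exists2 f : {ffun 'I_n -> 'I_n}, [forall j, (f j <= j)%N] &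
  exists2 u, u \in fix_ge m & p = (u * \prod_(m <= j < k) tperm_at f j)%g.
Proof.
case/andP => le_mk; rewrite -(subnKC le_mk); elim: (k - m)%N p => [|d IHd] p le_n fp.
  exists [ffun j => j]; first by apply/forallP => j; rewrite ffunE.
  by rewrite addn0 in fp *; exists p; rewrite // big_geq // mulg1.
rewrite addnS in le_n fp *; pose i0 := Ordinal le_n.
have le_p : (p i0 <= i0)%N by rewrite -ltnS; apply: fix_ge_lt fp _.
have fp' : (p * tperm (p i0) i0)%g \in fix_ge (m + d).
  apply/fix_geP => j; rewrite leq_eqVlt permM => /predU1P[ej|lt_j].
    by have -> : j = i0 by [apply: val_inj]; rewrite tpermL.
  have pj : p j = j by apply: (fix_geP _ _ fp).
  have ne_j : j != i0 by rewrite -val_eqE /= gtn_eqF.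
  have ne_pj : p i0 != j by rewrite -pj (inj_eq perm_inj) eq_sym.
  by rewrite pj tpermD // eq_sym.
have [f le_f [u fu pE]] := IHd _ (ltnW le_n) fp'.
exists [ffun j => if j == i0 then p i0 else f j].
  by apply/forallP => j; rewrite ffunE; case: eqP => [->|_] //; apply: (forallP le_f).
exists u => //; rewrite big_nat_recr ?leq_addr //= mulgA.
rewrite [X in (_ * X * _)%g](@eq_big_nat _ _ _ _ _ _ (tperm_at f)) => [|j /andP[_ lt_j]].
  rewrite -pE /tperm_at (insubT (fun j => j < n)%N le_n) ffunE eqxx.
  by rewrite -mulgA tperm2 mulg1.
have lt_jn : (j < n)%N by apply: ltn_trans lt_j le_n.
rewrite /tperm_at (insubT (fun j => j < n)%N lt_jn) ffunE -val_eqE /= ltn_eqF //.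
Qed.

Lemma star_permsP r d :
  reflect (exists2 f : {ffun 'I_n -> 'I_n}, [forall j, (f j <= j)%N] & d = star_prod (n - r) f)
          (d \in star_perms r n).
Proof. by apply: (iffP imsetP) => [][f lef ->]; exists f; rewrite ?inE // in lef *. Qed.

(** As u fixes every j >= n - r, conjugation replaces f j by u (f j). The bound u (f j) <= j
    persists because u preserves the set of points below n - r. *)
Lemma star_perms_conj r d u : u \in fix_ge (n - r) -> d \in star_perms r n ->
  (d ^ u)%g \in star_perms r n.
Proof.
move=> fu /star_permsP[f le_f ->]; apply/star_permsP.
exists [ffun j : 'I_n => if (n - r <= j)%N then u (f j) else j].
  apply/forallP => j; rewrite ffunE; case: (leqP (n - r) j) => // le_j.
  have [le_fj|lt_fj] := leqP (n - r) (f j).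
    by rewrite (fix_geP _ _ fu _ le_fj) (forallP le_f).
  by rewrite (leq_trans (ltnW (fix_ge_lt fu lt_fj)) le_j).
rewrite /star_prod conjg_prod; apply: eq_bigr => j le_j.
by rewrite tpermJ ffunE le_j (fix_geP _ _ fu _ le_j).
Qed.

(** [fix_ge_factor] leaves the subgroup element on the left; conjugation moves it to the right. *)
Lemma star_perms_factor r (p : 'S_n) :
  exists2 d, d \in star_perms r n & exists2 u, u \in fix_ge (n - r) & p = (d * u)%g.
Proof.
have fp : p \in fix_ge n by apply/fix_geP => j; rewrite leqNgt ltn_ord.
have [|f le_f [u fu ->]] := fix_ge_factor (m := n - r) _ fp; first by rewrite leq_subr leqnn.
rewrite -star_prodE conjgCV; exists (star_prod (n - r) f ^ u^-1)%g; last by exists u.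
by apply: star_perms_conj; [exact: fix_geV | apply/star_permsP; exists f].
Qed.

(** An upper bound from the number of choices of f. Together with surjectivity of the factorization
    it forces uniqueness by counting. *)
Lemma card_star_perms r : (#|star_perms r n| * (n - r)`! <= n`!)%N.
Proof.
set m := (n - r)%N.
(* Values of f below m do not enter the product; making f the identity there avoids counting
   them. *)
pose dom (j : 'I_n) : pred 'I_n := fun i => if (m <= j)%N then (i <= j)%N else i == j.
have sub : star_perms r n \subset [set star_prod m f | f in family dom].
  apply/subsetP => d /star_permsP[f le_f ->]; apply/imsetP.
  exists [ffun j : 'I_n => if (m <= j)%N then f j else j].
    apply/familyP => j; rewrite ffunE unfold_in /dom /=.
    by case: (leqP m j) => // _; exact: (forallP le_f j).
  by apply: eq_bigr => j le_j; rewrite ffunE le_j.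
have := leq_trans (subset_leq_card sub) (leq_imset_card _ _).
rewrite card_family foldrE big_map => le_S; apply: leq_trans (leq_mul le_S (leqnn _)) _.
have cdom (j : 'I_n) : #|dom j| = (if (m <= j)%N then j.+1 else 1)%N.
  rewrite /dom; case: leqP => le_j; last by rewrite card1.
  by rewrite -[RHS](card_ord_lt (ltn_ord j)) cardsE; apply: eq_card => i; rewrite !unfold_in.
rewrite big_enum (eq_bigr _ (fun j _ => cdom j)) -big_mkcond /= -(big_geq_mkord _ _ xpredT succn).
rewrite !fact_prod !big_add1 /= mulnC -big_cat_nat ?leq_subr //.
Qed.

Lemma star_perms_sum r (V : nmodType) (h : 'S_n -> V) :
  (forall d u, u \in fix_ge (n - r) -> h (d * u)%g = h d) ->
  \sum_(p : 'S_n) h p = (\sum_(d in star_perms r n) h d) *+ (n - r)`!.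
Proof.
move=> Hh; set m := (n - r)%N; pose D := setX (star_perms r n) (fix_ge m).
pose g (x : 'S_n * 'S_n) := (x.1 * x.2)%g.
have gD : [set g x | x in D] = [set: 'S_n].
  apply/setP => p; rewrite inE; apply/imsetP.
  have [d dS [u uU ->]] := star_perms_factor r p.
  by exists (d, u); rewrite // inE /= dS.
have g_inj : {in D &, injective g}.
  apply/imset_injP; rewrite gD cardsT card_Sn eqn_leq.
  have cD : #|D| = (#|star_perms r n| * m`!)%N by rewrite cardsX card_fix_ge ?leq_subr.
  rewrite {2}cD card_star_perms andbT -card_Sn -cardsT -gD.
  exact: leq_imset_card.
transitivity (\sum_(p in [set g x | x in D]) h p).
  by rewrite gD; apply: eq_bigl => p; rewrite inE.
rewrite big_imset //= /D -sumrMnl.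
rewrite (eq_bigl (fun x => (x.1 \in star_perms r n) && (x.2 \in fix_ge m))) => [|x]; last first.
  by rewrite inE.
rewrite -(pair_big (mem (star_perms r n)) (mem (fix_ge m)) (fun d u => h (d * u)%g)) /=.
apply: eq_bigr => d _; rewrite (eq_bigr (fun=> h d)) => [|u uU]; last exact: Hh.
by rewrite sumr_const card_fix_ge ?leq_subr.
Qed.

End StarTransversal.

(** * Place permutations of words and the star product *)

Section StarProduct.
Variable R : comNzRingType.
Implicit Types (F G : ncseries R).

Definition ncplace n F := forall s1 s2, size s1 = n -> perm_eq s1 s2 -> F s1 = F s2.

Lemma nth_word_act n (d : 'S_n) w (i : 'I_n) :
  nth 0%N (word_act d w) i = nth 0%N w ((d^-1)%g i).
Proof. by rewrite /word_act (nth_map i) ?size_enum_ord // nth_ord_enum. Qed.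

Lemma size_word_act n (d : 'S_n) w : size (word_act d w) = n.
Proof. by rewrite size_map size_enum_ord. Qed.

(** With products composed from left to right, this is a right action on words of length n. *)
Lemma word_actM n (d e : 'S_n) w : word_act d (word_act e w) = word_act (e * d)%g w.
Proof.
apply: (@eq_from_nth _ 0%N) => [|i]; rewrite !size_word_act // => lt_i.
by rewrite !(nth_word_act _ _ (Ordinal lt_i)) nth_word_act invMg permM.
Qed.

Lemma word_act1 n w : size w = n -> word_act (1%g : 'S_n) w = w.
Proof.
move=> sz; apply: (@eq_from_nth _ 0%N) => [|i]; rewrite size_word_act ?sz // => lt_i.
by rewrite (nth_word_act _ _ (Ordinal lt_i)) invg1 perm1.
Qed.

Lemma word_act_perm n (d : 'S_n) w : size w = n -> perm_eq (word_act d w) w.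
Proof.
move=> sz; pose tw := Tuple (introT eqP sz).
apply/(@tuple_permP _ _ _ tw); exists (d^-1)%g.
apply: (@eq_from_nth _ 0%N) => [|i]; rewrite size_word_act ?size_tuple // => lt_i.
rewrite (nth_word_act _ _ (Ordinal lt_i)) -[i in RHS]/(nat_of_ord (Ordinal lt_i)).
by rewrite -tnth_nth tnth_mktuple (tnth_nth 0%N).
Qed.

Lemma perm_word_act n w w' : size w' = n -> perm_eq w w' -> exists e : 'S_n, w = word_act e w'.
Proof.
move=> sz; pose tw := Tuple (introT eqP sz).
rewrite -[w']/(tval tw) => /tuple_permP[e ew]; exists (e^-1)%g.
apply: (@eq_from_nth _ 0%N) => [|i]; rewrite ?size_word_act ew ?size_tuple // => lt_i.
rewrite (nth_word_act _ _ (Ordinal lt_i)) -[i in LHS]/(nat_of_ord (Ordinal lt_i)).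
by rewrite -tnth_nth tnth_mktuple (tnth_nth 0%N) invgK.
Qed.

Lemma star_size r n F G w : size w != n -> star r n F G w = 0.
Proof. by move=> nw; rewrite /star big1 // => d _; rewrite /ncact (negPf nw). Qed.

Lemma starE r n F G w : size w = n ->
  star r n F G w = \sum_(d in star_perms r n) ncmul F G (word_act d w).
Proof.
by move=> sz; apply: eq_bigr => d _; rewrite /ncact sz eqxx invgK.
Qed.

(** Multiplying d on the right by u in S_(n-r) permutes only the first n - r places, to which F is
    insensitive. The summand is therefore constant on cosets and [star_perms_sum] applies. *)
Lemma star_fact r n F G w : (r <= n)%N -> nchomog (n - r)%N F -> ncplace (n - r)%N F -> size w = n ->
  star r n F G w *+ (n - r)`! = \sum_(d : 'S_n) ncmul F G (word_act d w).
Proof.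
move=> le_r hF pF sz; rewrite starE // -star_perms_sum // => d u uU.
have sz2 (e : 'S_n) : size (word_act e w) = (n - r + r)%N by rewrite size_word_act subnK.
have eq_drop : drop (n - r) (word_act (d * u)%g w) = drop (n - r) (word_act d w).
  apply: (@eq_from_nth _ 0%N) => [|i]; rewrite !size_drop !size_word_act // => lt_i.
  rewrite !nth_drop; have lt_n : (n - r + i < n)%N by lia.
  rewrite !(nth_word_act _ _ (Ordinal lt_n)) invMg permM.
  by rewrite (fix_geP _ _ (fix_geV uU)) ?leq_addr.
rewrite !(@ncmul_homog _ (n - r)%N r) // eq_drop; congr (_ * _); apply: pF.
  by rewrite size_takel ?size_word_act ?leq_subr.
(* Cancelling the common suffix leaves two prefixes that are rearrangements of each other. *)
rewrite -(perm_cat2r (drop (n - r) (word_act d w))) -{1}eq_drop !cat_take_drop.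
apply: perm_trans (word_act_perm _ sz) _.
by rewrite perm_sym word_act_perm.
Qed.

Lemma star_place r n F G : (r <= n)%N -> nchomog (n - r)%N F -> ncplace (n - r)%N F ->
  ncplace n (fun w => star r n F G w *+ (n - r)`!).
Proof.
move=> le_r hF pF s1 s2 sz p12; have sz2 : size s2 = n by rewrite -(perm_size p12).
rewrite !star_fact //; have [e ->] := perm_word_act sz2 p12.
under eq_bigr => d _ do rewrite word_actM.
rewrite (reindex_inj (mulgI (e^-1)%g)); apply: eq_bigr => d _.
by rewrite mulgA mulgV mul1g.
Qed.

Lemma nceval_act N n (d : 'S_n) F : nceval N n (fun w => F (word_act d w)) = nceval N n F.
Proof.
have actP w : size w = n -> mcontent N (word_act d w) = mcontent N w.
  by move=> sz; apply: mcontent_perm; apply: word_act_perm.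
have perm_words : perm_eq [seq word_act d w | w <- words N n] (words N n).
  have inj : {in words N n &, injective (word_act d)}.
    move=> s1 s2; rewrite !mem_words => /andP[/eqP z1 _] /andP[/eqP z2 _].
    by move/(congr1 (word_act (d^-1)%g)); rewrite !word_actM mulgV !word_act1.
  apply: uniq_perm; rewrite ?(map_inj_in_uniq inj) ?uniq_words // => s.
  apply/mapP/idP => [[w + ->]|].
    rewrite !mem_words => /andP[/eqP sz lt_w]; rewrite size_word_act eqxx /=.
    by rewrite (perm_all _ (word_act_perm d sz)).
  rewrite mem_words => /andP[/eqP sz lt_s]; exists (word_act (d^-1)%g s); last first.
    by rewrite word_actM mulVg word_act1.
  by rewrite mem_words size_word_act eqxx (perm_all _ (word_act_perm _ sz)).
rewrite /nceval -[RHS](perm_big _ perm_words) big_map; apply: eq_big_seq => w.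
by rewrite mem_words => /andP[/eqP sz _]; rewrite actP.
Qed.

Lemma nceval_star N r n F G : (r <= n)%N -> nchomog (n - r)%N F -> ncplace (n - r)%N F ->
  nceval N n (fun w => star r n F G w *+ (n - r)`!) =
  (nceval N (n - r)%N F * nceval N r G) *+ n`!.
Proof.
move=> le_r hF pF.
rewrite (eq_nceval _ (G := fun w => \sum_(d : 'S_n) ncmul F G (word_act d w))); last first.
  by move=> w sz; rewrite star_fact.
transitivity (\sum_(d : 'S_n) nceval N n (fun w => ncmul F G (word_act d w))).
  by rewrite /nceval exchange_big; apply: eq_bigr => w _; rewrite scaler_suml.
under eq_bigr => d _ do rewrite nceval_act.
rewrite sumr_const card_Sn; congr (_ *+ _).
by rewrite -nceval_mul // subnK.
Qed.

End StarProduct.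

(** * Lifted functions *)

Definition mnm_fact N (m : 'X_{1..N}) : nat := (\prod_(i < N) (m i)`!)%N.

Lemma mnm_factS N (m : 'X_{1..N}) (i : 'I_N) : (0 < m i)%N ->
  mnm_fact m = (m i * mnm_fact (m - U_(i))%MM)%N.
Proof.
move=> mi; rewrite /mnm_fact (bigD1 i) //= [in RHS](bigD1 i) //= mulnA.
congr (_ * _)%N; last first.
  by apply: eq_bigr => j ne_j; rewrite mnmBE mnm1E eq_sym (negPf ne_j) subn0.
by rewrite mnmBE mnm1E eqxx subn1 -[in LHS](prednK mi) factS prednK.
Qed.

(** Multinomial count by the first letter i: removing it divides the product of factorials by m_i,
    and the m_i add up to the length. *)
Lemma count_words_content N n (m : 'X_{1..N}) : mdeg m = n ->
  (mnm_fact m * count (fun s => mcontent N s == m) (words N n) = n`!)%N.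
Proof.
elim: n m => [|n IHn] m dm.
  move/eqP: dm; rewrite mdeg_eq0 => /eqP->; rewrite /= addn0.
  rewrite (_ : mcontent N [::] = 0%MM) ?eqxx ?muln1.
    by rewrite /mnm_fact big1 // => i _; rewrite mnm0E.
  by apply/mnmP => i; rewrite [LHS]mcontentE [RHS]mnm0E.
rewrite -sum1_count big_mkcond big_allpairs_dep (_ : iota 0 N = index_iota 0 N); last first.
  by rewrite /index_iota subn0.
rewrite big_mkord big_distrr /=.
transitivity (\sum_(i < N) m i * n`!)%N; last by rewrite -big_distrl -mdegE dm factS.
apply: eq_bigr => i _; rewrite -big_mkcond sum1_count.
have [mi0|mi] := posnP (m i).
  rewrite mi0 mul0n (_ : count _ _ = 0%N) ?muln0 //.
  apply/eqP; rewrite -leqn0 leqNgt -has_count; apply/hasPn => s _.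
  rewrite mcontent_cons; apply/eqP => /mnmP/(_ i).
  by rewrite mnmDE mnm1E eqxx mi0.
have le_m : (U_(i) <= m)%MM by rewrite lep1mP -lt0n.
rewrite (mnm_factS mi) -mulnA -(IHn (m - U_(i))%MM); last first.
  by have := dm; rewrite -{1}(submK le_m) mdegD mdeg1 addn1 => -[].
congr (_ * (_ * _))%N; apply: eq_count => s.
rewrite mcontent_cons; apply/eqP/eqP => [<-|->]; first by rewrite addmC addmK.
by rewrite addmC submK.
Qed.

(** * Set partitions of the places of a word *)

Section Kernel.
Variables (n : nat) (w : seq nat).
Hypothesis szw : size w = n.

(** The only set partition whose noncommutative monomial function contains w. *)
Definition word_kernel : {set {set 'I_n}} :=
  preim_partition (fun a : 'I_n => nth 0%N w a) [set: 'I_n].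

Lemma nc_monomial_kernel (R : nzRingType) (s : {set {set 'I_n}}) :
  partition s [set: 'I_n] -> nc_monomial R s w = (s == word_kernel)%:R.
Proof.
move=> ps; have /and3P[/eqP cs tI _] := ps.
have relE (s' : {set {set 'I_n}}) a b : partition s' [set: 'I_n] ->
    [exists B in s', (a \in B) && (b \in B)] = (b \in pblock s' a).
  case/and3P=> /eqP cs' tI' _; apply/existsP/idP => [[B /and3P[Bs aB bB]]|bB].
    by rewrite (def_pblock tI' Bs aB).
  exists (pblock s' a); rewrite bB pblock_mem ?mem_pblock cs' ?inE //.
have -> : nc_monomial R s w = [forall a : 'I_n, forall b : 'I_n,
    (nth 0%N w a == nth 0%N w b) == (b \in pblock s a)]%:R.
  rewrite /nc_monomial szw eqxx /=.
  rewrite (eq_forallb (P2 := fun a : 'I_n => [forall b : 'I_n, (nth 0%N w a == nth 0%N w b) ==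
    (b \in pblock s a)])) => [|a].
    by case: ifP.
  by apply: eq_forallb => b; rewrite relE.
congr (_ : bool)%:R; apply/idP/eqP => [/forallP H|->].
  rewrite -(equivalence_partition_pblock ps) /word_kernel /preim_partition /equivalence_partition.
  apply: eq_imset => a; apply/setP => b; rewrite !inE /=.
  by have /eqP-> := forallP (H a) b.
apply/forallP => a; apply/forallP => b; apply/eqP.
rewrite /word_kernel /preim_partition pblock_equivalence_partition ?inE //.
by move=> x y z _ _ _ /=; split=> // /eqP->.
Qed.

Lemma word_kernel_type N : all (fun c => (c < N)%N) w ->
  perm_eq [seq #|B| | B : {set 'I_n} <- enum word_kernel] [seq k <- mcontent N w | (0 < k)%N].
Proof.
move=> lt_w; pose B c := [set a : 'I_n | nth 0%N w a == c].
have cB c : #|B c| = count_mem c w.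
  rewrite card_nth_eq ?szw // subnn; by case: ifP; rewrite addn0.
have in_w (a : 'I_n) : nth 0%N w a \in w by rewrite mem_nth ?szw.
have B_inj : {in undup w &, injective B}.
  move=> c d; rewrite !mem_undup => /(nthP 0%N)[i]; rewrite szw => lt_i <- _ /setP/(_ (Ordinal lt_i)).
  by rewrite !inE eqxx => /esym/eqP.
have pB : perm_eq (enum word_kernel) [seq B c | c <- undup w].
  apply: uniq_perm; rewrite ?enum_uniq ?(map_inj_in_uniq B_inj) ?undup_uniq // => A.
  rewrite mem_enum; apply/imsetP/mapP => [[a _ ->]|[c]].
    exists (nth 0%N w a); first by rewrite mem_undup.
    by apply/setP => b; rewrite !inE eq_sym.
  rewrite mem_undup => /(nthP 0%N)[i]; rewrite szw => lt_i <- ->.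
  by exists (Ordinal lt_i) => //; apply/setP => b; rewrite !inE eq_sym.
apply: perm_trans (perm_map _ pB) _; rewrite -map_comp (eq_map (g := fun c => count_mem c w)) //.
have -> : mcontent N w = [seq count_mem c w | c <- iota 0 N] :> seq nat.
  apply: (@eq_from_nth _ 0%N) => [|i]; first by rewrite size_tuple size_map size_iota.
  rewrite size_tuple => lt_i; rewrite -(tnth_nth _ _ (Ordinal lt_i)) -mnm_tnth mcontentE.
  by rewrite (nth_map 0%N) ?size_iota // nth_iota.
rewrite filter_map; apply: perm_map; apply: uniq_perm; rewrite ?undup_uniq ?filter_uniq ?iota_uniq //.
move=> c; rewrite mem_undup mem_filter mem_iota /= -has_count has_pred1.
by apply/idP/andP => [cw|[]//]; rewrite cw (allP lt_w).
Qed.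

End Kernel.

Lemma setpart_type_eq n (s : {set {set 'I_n}}) (mu : intpart n) :
  (setpart_type s == mu) = perm_eq [seq #|B| | B : {set 'I_n} <- enum s] mu.
Proof.
have /and3P[smu _ _] : is_part n mu := valP mu.
rewrite /setpart_type; apply/eqP/idP => [<-|p]; first by rewrite perm_sym perm_sort.
apply: (sorted_eq (leT := geq)) => //.
- by move=> x y z /= xy yz; apply: leq_trans yz xy.
- by move=> x y /andP[/= h1 h2]; apply/eqP; rewrite eqn_leq h1 h2.
- by apply: sort_sorted => x y; exact: leq_total.
by rewrite perm_sort.
Qed.

Lemma part_fact_content N (m : 'X_{1..N}) (mu : seq nat) :
  perm_eq [seq k <- m | (0 < k)%N] mu -> part_fact mu = mnm_fact m.
Proof.
move=> p; rewrite /part_fact -(perm_big _ p) big_filter big_tuple big_mkcond.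
by apply: eq_bigr => i _; rewrite -mnm_tnth; case: (m i).
Qed.

Lemma liftedHL_size n (la : intpart n) : nchomog n (liftedHL la).
Proof.
move=> w nw; rewrite /liftedHL big1 // => mu _; rewrite big1 ?mulr0 // => s _.
by rewrite /nc_monomial (negPf nw).
Qed.

(** Only the set partition [word_kernel n w] contributes, and its type is the sorted content of w;
    so mu! is the product of the factorials of the multiplicities in w. *)
Lemma liftedHLE N n (la : intpart n) w : size w = n -> all (fun c => (c < N)%N) w ->
  liftedHL la w = (mnm_fact (mcontent N w))%:R * (HLpoly N la)@_(mcontent N w).
Proof.
move=> sz lt_w; rewrite HLpolyE raddf_sum mulr_sumr; apply: eq_bigr => mu _ /=.
rewrite mcoeffZ mcoeff_monomial_sym.
have -> : \sum_(s : {set {set 'I_n}} | partition s [set: 'I_n] && (setpart_type s == mu))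
    nc_monomial {poly int} s w = (perm_eq [seq k <- mcontent N w | (0 < k)%N] mu)%:R.
  have pk : partition (word_kernel n w) [set: 'I_n] by apply: preim_partitionP.
  rewrite (eq_bigr (fun s => (s == word_kernel n w)%:R)) => [|s /andP[ps _]]; last first.
    exact: nc_monomial_kernel.
  have typeE : (setpart_type (word_kernel n w) == mu) =
      perm_eq [seq k <- mcontent N w | (0 < k)%N] mu.
    by rewrite setpart_type_eq (permPl (word_kernel_type sz lt_w)).
  have [tmu|tmu] := boolP (perm_eq _ mu).
    rewrite (bigD1 (word_kernel n w)) /= ?pk ?typeE // eqxx big1 ?addr0 // => s /andP[_ ne].
    by rewrite (negPf ne).
  rewrite big1 // => s /andP[_ ts]; case: eqP => // es.
  by move: tmu; rewrite -typeE -es ts.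
have [p|_] := boolP (perm_eq _ mu); last by rewrite !mulr0.
by rewrite !mulr1 (part_fact_content p).
Qed.

Lemma seq_bound (w : seq nat) : exists N, all (fun c => (c < N)%N) w.
Proof.
exists (sumn w).+1; apply/allP => c /mem_leq_sumn; by rewrite ltnS.
Qed.

Lemma liftedHL_place n (la : intpart n) : ncplace n (liftedHL la).
Proof.
move=> s1 s2 sz p; have [N ltN] := seq_bound s1.
rewrite (liftedHLE la sz ltN) (liftedHLE la (N := N)) -?(perm_size p) -?(perm_all _ p) //.
by rewrite (mcontent_perm N p).
Qed.

(** Each word of content m carries m! times the coefficient of x^m in P_la, and there are n!/m! such
    words. *)
Lemma nceval_liftedHL N n (la : intpart n) :
  nceval N n (liftedHL la) = HLpoly N la *+ n`!.
Proof.
apply/mpolyP => m; rewrite mcoeffMn.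
have [dm|ndm] := eqVneq (mdeg m) n; last first.
  by rewrite mcoeff_nceval_deg // /HLpoly mcoeff_nceval_deg // mul0rn.
rewrite mcoeff_nceval big_seq_cond.
rewrite (eq_bigr (fun=> (HLpoly N la)@_m *+ mnm_fact m)) => [|s]; last first.
  case/andP; rewrite mem_words => /andP[/eqP sz lt_s] /eqP em.
  by rewrite (liftedHLE la sz lt_s) em mulr_natl.
by rewrite -big_seq_cond big_const_seq iter_addr_0 -mulrnA count_words_content.
Qed.

Lemma polyint_mulrn_inj (p q : {poly int}) k : (0 < k)%N -> p *+ k = q *+ k -> p = q.
Proof.
move=> k_gt0 e; apply/polyP => i; have := congr1 (fun p : {poly int} => p`_i) e.
by rewrite !coefMn => /eqP; rewrite Num.Theory.eqr_pMn2r // => /eqP.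
Qed.

Lemma mcontent_perm_inj N s1 s2 : all (fun c => (c < N)%N) s1 ->
  all (fun c => (c < N)%N) s2 -> mcontent N s1 = mcontent N s2 -> perm_eq s1 s2.
Proof.
move=> l1 l2 e; apply/allP => c; rewrite mem_cat => cs /=.
have lt_c : (c < N)%N by case/orP: cs => [/(allP l1)|/(allP l2)].
by have /mnmP/(_ (Ordinal lt_c)) := e; rewrite !mcontentE => ->.
Qed.

(** All words of content m share one coefficient, so the image contains x^m with that coefficient
    times a positive number of words, which can be cancelled in Z[t]. *)
Lemma nceval_place_inj n (X Y : ncseries {poly int}) : ncplace n X -> ncplace n Y ->
  (forall N, nceval N n X = nceval N n Y) -> forall w, size w = n -> X w = Y w.
Proof.
move=> pX pY e w sz; have [N lt_w] := seq_bound w; set m := mcontent N w.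
have coefE Z : ncplace n Z ->
    (nceval N n Z)@_m = Z w *+ count (fun s => mcontent N s == m) (words N n).
  move=> pZ; rewrite mcoeff_nceval big_seq_cond.
  rewrite (eq_bigr (fun=> Z w)) => [|s]; last first.
    case/andP; rewrite mem_words => /andP[/eqP szs lt_s] /eqP em.
    by apply: pZ => //; apply: mcontent_perm_inj lt_s lt_w _.
  by rewrite -big_seq_cond big_const_seq iter_addr_0.
apply: (@polyint_mulrn_inj _ _ (count (fun s => mcontent N s == m) (words N n))).
  rewrite -has_count; apply/hasP; exists w; last exact: eqxx.
  by rewrite mem_words sz eqxx.
by rewrite -!coefE // e.
Qed.

(** Both sides are compared after multiplication by (n-r)!, where place invariance is available. The
    images are then (n-r)! n! P_mu P_nu; on the left the factor (n-r)! comes from lifting P_mu, and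
    n! from the sum over all place permutations. *)
Lemma star_liftedHL n r (mu : intpart (n - r)) (nu : intpart r) w : (r <= n)%N ->
  star r n (liftedHL mu) (nonliftedHL nu) w =
  \sum_(la : intpart n) hl_coef mu nu la * liftedHL la w.
Proof.
move=> le_r; have [sz|nw] := eqVneq (size w) n; last first.
  by rewrite star_size // big1 // => la _; rewrite liftedHL_size ?mulr0.
apply: (@polyint_mulrn_inj _ _ (n - r)`!); first exact: fact_gt0.
move: w sz; apply: (nceval_place_inj (n := n)).
- by apply: star_place => //; [exact: liftedHL_size | exact: liftedHL_place].
- move=> s1 s2 sz p; congr (_ *+ _); apply: eq_bigr => la _.
  by rewrite (liftedHL_place la sz p).
move=> N; rewrite nceval_star //; try exact: liftedHL_size; try exact: liftedHL_place.
rewrite nceval_liftedHL -/(HLpoly N nu) mulrnAl HLpoly_mul // mulrnAC.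
rewrite -sumrMnl -sumrMnl /nceval.
under [RHS]eq_bigr => s _ do rewrite -sumrMnl scaler_suml.
rewrite exchange_big; apply: eq_bigr => la _ /=.
rewrite scalerMnr -nceval_liftedHL /nceval scaler_sumr -sumrMnl; apply: eq_bigr => s _.
by rewrite scalerA scalerMnl.
Qed.

Lemma star_at0 n r (F G : ncseries {poly int}) w :
  star r n (nc_at0 F) (nc_at0 G) w = (star r n F G w).[0].
Proof.
rewrite -at0E /star rmorph_sum; apply: eq_bigr => d _; rewrite /ncact.
case: ifP => _; last by rewrite /= rmorph0.
rewrite /ncmul /= rmorph_sum; apply: eq_bigr => k _.
by rewrite /= rmorphM.
Qed.

Theorem theorem4p1 (n r : nat) (hn : (2 <= n)%N) (hr : (1 <= r <= n - 1)%N)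
    (mu : intpart (n - r)) (nu : intpart r) :
  [/\ is_hl_product_expansion mu nu (@hl_coef n mu nu),
      forall w : seq nat,
        star r n (liftedHL mu) (nonliftedHL nu) w =
        \sum_(la : intpart n) hl_coef mu nu la * liftedHL la w,
      forall la : intpart n, (hl_coef mu nu la).[0] = lr_coef mu nu la &
      forall w : seq nat,
        star r n (liftedSchur mu) (nonliftedSchur nu) w =
        \sum_(la : intpart n) lr_coef mu nu la * liftedSchur la w].
Proof.
have le_r : (r <= n)%N by move: hr; lia.
split=> [|w|la|w].
- exact: hl_coefP.
- exact: star_liftedHL.
- exact: hl_coef_at0.
rewrite star_at0 star_liftedHL // horner_sum; apply: eq_bigr => la _.
by rewrite hornerM hl_coef_at0.
Qed.
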